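(* Let $K=K_1\times K_2$ be a closed (possibly unbounded) rectangle in $\mathbb{R}^d$ with $0\in K_1^\circ$. Let $(\Omega,\mathcal{F},\mathbf{P})$ be a probability space and let $(\Psi_n,\Gamma_n)_{n\ge1}$ and $(\Psi_0,\Gamma_0)$ be random elements taking values in $\mathcal{D}_K^0\times\mathcal{S}_{K_1}$ such that, for every $n\ge 0$, almost surely $\Psi_n$ can be written in the form (J) for the sequence of jumps of $\Gamma_n$. Suppose moreover that, with probability one: $\Psi_0$ can be written in the form (J) for the sequence of jumps of $\Gamma_0$ with continuous functions $V_j:K_2\to\mathbb{R}$, $j\in\mathbb{Z}$, each having a unique maximizer on $K_2$, such that for every finite nonempty $A\subset\mathbb{Z}$ there is only one $j\in A$ with $\max_{m\in A}\{\sup_{\xi\in K_2}V_m(\xi)\}=\sup_{\xi\in K_2}V_j(\xi)$; and the sargmax and largmax of $\Psi_0$ over $K$ are well defined (finite). Suppose also that $\Gamma_0$ has no fixed time of discontinuity, i.e. $\mathbf{P}(\Gamma_0\text{ jumps at }t)=0$ for every $t\in K_1$. If (i) for every compact subinterval $B_1\subset K_1$ and compact sub-rectangle $B:=B_1\times B_2\subset K$, the restrictions satisfy $(\Psi_n|_B,\Gamma_n|_{B_1})\rightsquigarrow(\Psi_0|_B,\Gamma_0|_{B_1})$ as $n\to\infty$ with respect to the product of the Skorohod topologies given by $d_B$ and $d_{B_1}$; and (ii) $\left(\operatorname{sargmax}_{\theta\in K}\{\Psi_n(\theta)\},\operatorname{largmax}_{\theta\in K}\{\Psi_n(\theta)\}\right)=O_{\mathbf{P}}(1)$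 (in particular these are well defined almost surely for $n\ge1$); then $$\left(\operatorname{sargmax}_{\theta\in K}\{\Psi_n(\theta)\},\operatorname{largmax}_{\theta\in K}\{\Psi_n(\theta)\}\right)\rightsquigarrow\left(\operatorname{sargmax}_{\theta\in K}\{\Psi_0(\theta)\},\operatorname{largmax}_{\theta\in K}\{\Psi_0(\theta)\}\right)\quad\text{as } n\to\infty.$$
   Context: $\rightsquigarrow$ denotes weak convergence (convergence in distribution); $O_{\mathbf{P}}(1)$ means bounded in probability (tight). Coordinates of vectors are written with upper indices. A closed rectangle is a product $K=K_1\times K_2$ of possibly unbounded nondegenerate closed intervals, $K_1\subset\mathbb{R}$ being the first factor and $K_2\subset\mathbb{R}^{d-1}$ the product of the remaining $d-1$ (when $d=1$, $K_2$ is a one-point set and functions on $K_2$ are constants). Space $\mathcal{D}_K^0$: all functions $\psi:K_1\times K_2\to\mathbb{R}$ that can be written, for $(t,\xi)\in K_1\times K_2$, as $$\text{(J)}\quad \psi(t,\xi)=V_0(\xi)\mathbf{1}_{a_{-1}\le t<a_1}+\sum_{k=1}^\infty V_k(\xi)\mathbf{1}_{a_k\le t<a_{k+1}}+\sum_{k=1}^\infty V_{-k}(\xi)\mathbf{1}_{a_{-k-1}\le t<a_{-k}},$$ where $(\dots<a_{-k-1}<a_{-k}<\dots<a_0=0<\dots<a_k<a_{k+1}<\dots)$ is a strictly increasing real sequence with $a_k\to\infty$, $a_{-k}\to-\infty$ as $k\to\infty$ (the ''jumps''; $a_0=0$ is only a placeholder and not a jump), and $V_k:K_2\to\mathbb{R}$,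 $k\in\mathbb{Z}$, are continuous. Space $\mathcal{S}$: all piecewise constant càdlàg $\tilde\psi:\mathbb{R}\to\mathbb{R}$ with $\tilde\psi(0)=0$, all jumps of size 1 (in absolute value), and $t\mapsto\tilde\psi(t)$, $t\mapsto\tilde\psi(-t)$ nondecreasing on $(0,\infty)$; for a closed interval $I$, $\mathcal{S}_I=\{f|_I: f\in\mathcal{S}\}$. $\psi\in\mathcal{D}^0_K$ can be written in the form (J) for the sequence of jumps of $\tilde\psi\in\mathcal{S}_{K_1}$ if there is a strictly increasing real sequence $(a_k)_{k\in\mathbb{Z}}$ with $a_0=0$ and $a_k\to\infty$, $a_{-k}\to-\infty$ as $k\to\infty$, and continuous $V_k:K_2\to\mathbb{R}$, $k\in\mathbb{Z}$, such that (J) holds on $K$ and $\tilde\psi(t)=\sum_{k\ge1}\mathbf{1}_{a_k\le t}+\sum_{k\ge1}\mathbf{1}_{a_{-k}>t}$ for all $t\in K_1$. Skorohod metric: for a compact interval $I$ let $\Lambda_I$ be the set of strictly increasing surjections $\lambda:I\to I$ and $|||\lambda|||_I=\sup_{s\ne t}\left|\log\frac{\lambda(t)-\lambda(s)}{t-s}\right|\in[0,\infty]$. For a compact rectangle $B=\prod_k[u^k,v^k]$ and $\lambda=(\lambda_1,\dots,\lambda_d)\in\Lambda_B:=\prod_k\Lambda_{[u^k,v^k]}$ put $|||\lambda|||_B=\max_k|||\lambda_k|||_{[u^k,v^k]}$ and let $\lambda$ act on $B$ coordinatewise. For bounded $f,g:B\to\mathbb{R}$, $d_B(f,g)=\inf_{\lambda\in\Lambda_B}\{|||\lambda|||_B+\sup_{x\in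 B}|f(x)-g(\lambda(x))|\}$. $d_{B_1}$ is the same metric for the one-dimensional rectangle $B_1$. The restrictions $(\Psi_n|_B,\Gamma_n|_{B_1})$ are regarded as random elements of the metric space $\mathcal{D}_B^0\times\mathcal{S}_{B_1}$ with these metrics, where, for $B=B_1\times B_2$, $\mathcal{D}_B^0$ is the set of all functions $\psi:B_1\times B_2\to\mathbb{R}$ that can be written, for $(t,\xi)\in B_1\times B_2$, as $\psi(t,\xi)=V_0(\xi)\mathbf{1}_{a_{-1}\le t<a_1}+\sum_{k=1}^\infty V_k(\xi)\mathbf{1}_{a_k\le t<a_{k+1}}+\sum_{k=1}^\infty V_{-k}(\xi)\mathbf{1}_{a_{-k-1}\le t<a_{-k}}$ with a strictly increasing real sequence $(a_k)_{k\in\mathbb{Z}}$ satisfying $a_0=0$, $a_k\to\infty$ and $a_{-k}\to-\infty$ as $k\to\infty$, and continuous functions $V_k:B_2\to\mathbb{R}$, $k\in\mathbb{Z}$, and where $\mathcal{S}_{B_1}=\{f|_{B_1}:f\in\mathcal{S}\}$; that $(\Psi_n,\Gamma_n)$ is a random element of $\mathcal{D}_K^0\times\mathcal{S}_{K_1}$ means that all these restrictions are Borel measurable. Maximizers: for $x\in K$ and $\rho\in\{-,+\}^d$ let $Q(\rho,x)$ be the set of $y\in K$ with $y^k<x^k$ whenever $\rho^k=-$ and $y^k>x^k$ whenever $\rho^k=+$. If $Q(\rho,x)\ne\emptyset$, $f(x+0_\rho)$ is the common limit of $f(x_n)$ over all sequences $(x_n)\subset Q(\rho,x)$ with $x_n\to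 x$. A point $x\in K$ is a maximizer of $f\in\mathcal{D}^0_K$ over $K$ if $f(x)$ or one of the limits $f(x+0_\rho)$ equals $\sup_{K}f$. $\operatorname{sargmax}_{\theta\in K}\{f(\theta)\}$ is the maximizer $x$ such that every maximizer $\xi$ has $x^1\le\xi^1$, and, for each $k\in\{1,\dots,d-1\}$, every maximizer $\xi$ with $\xi^j=x^j$ for $j=1,\dots,k$ has $x^{k+1}\le\xi^{k+1}$ (the lexicographically smallest maximizer); $\operatorname{largmax}$ is defined with the inequalities reversed. Since $K$ need not be compact these may fail to exist; they are called well defined (finite) if such an element of $K$ exists. *)

(* Defs.v *)
From HB Require Import structures.
From mathcomp Require Import all_boot all_order all_algebra.
From mathcomp Require Import all_classical all_reals all_analysis.

Set Implicit Arguments.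
Unset Strict Implicit.
Unset Printing Implicit Defensive.

Import Order.TTheory GRing.Theory Num.Theory.
Import numFieldNormedType.Exports.

Local Open Scope classical_set_scope.
Local Open Scope ring_scope.

(* Conventions.  R^d is 'rV[R]_d, with d = m.+1 when a first coordinate is
   singled out.  A rectangle is given by the family of its sides; K ord0 is
   K_1 and the remaining sides form K_2 (for m = 0, K_2 is the one-point set
   'rV_0).  A function on a rectangle is represented by a total function, of
   which only the values on the rectangle are ever used. *)

Section rectangles.
Variable R : realType.

Definition rect n (K : 'I_n -> set R) : set 'rV[R]_n :=
  [set x | forall k, K k (x 0 k)].

Definition closed_interval (I : set R) :=
  [/\ is_interval I, closed I & exists x y, [/\ I x, I y & x < y]].

Definition closed_rectangle n (K : 'I_n -> set R) :=
  forall k, closed_interval (K k).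

Definition compact_rectangle n (B : 'I_n -> set R) :=
  closed_rectangle B /\ forall k, compact (B k).

Definition subrectangle n (B K : 'I_n -> set R) := forall k, B k `<=` K k.

Definition tail_sides m (K : 'I_m.+1 -> set R) : 'I_m -> set R :=
  fun k => K (lift ord0 k).

Definition tail_coords m (x : 'rV[R]_m.+1) : 'rV[R]_m :=
  \row_k x 0 (lift ord0 k).

Definition sup_on (T : Type) (A : set T) (f : T -> R) : \bar R :=
  ereal_sup [set (f x)%:E | x in A].

Definition series_from1 (u : nat -> R) : R :=
  limn (fun n => \sum_(1 <= k < n) u k).

End rectangles.

Section jump_functions.
Variables (R : realType) (m : nat).
Implicit Types (K : 'I_m.+1 -> set R) (psi : 'rV[R]_m.+1 -> R).

Definition jump_sequence (a : int -> R) :=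
  [/\ {homo a : j k / j < k}, a 0 = 0,
      (a k%:Z) @[k --> \oo] --> +oo & (a (- k%:Z)) @[k --> \oo] --> -oo].

Definition form_J K psi (a : int -> R) (V : int -> 'rV[R]_m -> R) :=
  [/\ jump_sequence a,
      forall k, {within rect (tail_sides K), continuous (V k)} &
      forall x, rect K x ->
        let t := x 0 ord0 in let xi := tail_coords x in
        psi x = V 0 xi * (a (-1) <= t < a 1)%R%:R
          + series_from1 (fun k =>
              V k%:Z xi * (a k%:Z <= t < a (k%:Z + 1))%R%:R)
          + series_from1 (fun k =>
              V (- k%:Z) xi * (a (- k%:Z - 1) <= t < a (- k%:Z))%R%:R)].

Definition D0 K psi := exists a V, form_J K psi a V.

End jump_functions.

Section counting_functions.
Variable R : realType.
Implicit Types (f : R -> R) (I : set R).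

Definition cadlag f :=
  forall t, f x @[x --> t^'+] --> f t /\ cvg (f x @[x --> t^'-]).

(* On each [a, b], f is constant on every subinterval that avoids some finite
   set s of break points. *)
Definition piecewise_constant f :=
  forall a b : R, exists s : seq R, forall x y : R,
    a <= x -> x <= y -> y <= b ->
    (forall z, z \in s -> ~~ (x <= z <= y)) -> f x = f y.

Definition jump f t : R := f t - lim (f x @[x --> t^'-]).

Definition calS f :=
  [/\ piecewise_constant f, cadlag f, f 0 = 0,
      forall t, jump f t != 0 -> `|jump f t| = 1 &
      {in `]0, +oo[ &, {homo f : s t / s <= t}} /\
      {in `]0, +oo[ &, {homo (fun t => f (- t)) : s t / s <= t}}].

Definition calS_on I f := exists2 g, calS g & {in I, f =1 g}.

(* For a restriction of a cadlag function to I, a jump at t is a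
   discontinuity at t relative to I. *)
Definition jumps_at I f (t : R) := ~ (f x @[x --> within I (nbhs t)] --> f t).

Definition counts_jumps I f (a : int -> R) :=
  forall t, I t ->
    f t = series_from1 (fun k => (a k%:Z <= t)%R%:R)
        + series_from1 (fun k => (t < a (- k%:Z))%R%:R).

End counting_functions.

Definition form_J_for (R : realType) (m : nat) (K : 'I_m.+1 -> set R)
    (psi : 'rV[R]_m.+1 -> R) (f : R -> R) :=
  exists a V, form_J K psi a V /\ counts_jumps (K ord0) f a.

Section skorohod_distance.
Variable R : realType.

Definition time_change (I : set R) : set (R -> R) :=
  [set l | {in I &, {homo l : s t / s < t}} /\ l @` I = I].

Definition log_slope (I : set R) (l : R -> R) : \bar R :=
  ereal_sup [set z | exists s t, [/\ I s, I t, s != t &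
                       z = (`|ln ((l t - l s) / (t - s))|)%:E]].

Definition act n (l : 'I_n -> R -> R) (x : 'rV[R]_n) : 'rV[R]_n :=
  \row_k l k (x 0 k).

Definition skorohod_dist n (B : 'I_n -> set R) (f g : 'rV[R]_n -> R) : \bar R :=
  ereal_inf [set z | exists2 l, forall k, time_change (B k) (l k) &
    z = (\big[maxe/0]_k log_slope (B k) (l k)
         + sup_on (rect B) (fun x => `|f x - g (act l x)|)%R)%E].

Definition skorohod_dist1 (I : set R) (f g : R -> R) : \bar R :=
  skorohod_dist (fun _ : 'I_1 => I) (fun x => f (x 0 0))
    (fun x => g (x 0 0)).

End skorohod_distance.

Section open_for_distance.
Variables (R : realType) (T : Type) (D : T -> T -> \bar R).

Definition dist_open : set_system T :=
  [set U | forall f, U f ->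
     exists2 e : R, 0 < e & forall g, (D f g < e%:E)%E -> U g].

Lemma dist_openT : dist_open setT.
Proof. by move=> f _; exists 1. Qed.

Lemma dist_openI : setI_closed dist_open.
Proof.
move=> U V oU oV f [Uf Vf].
have [e e0 He] := oU _ Uf; have [e' e'0 He'] := oV _ Vf.
exists (Num.min e e'); first by rewrite lt_min e0 e'0.
move=> g fg; split; [apply: He|apply: He'];
  by apply: (lt_le_trans fg); rewrite lee_fin ge_min lexx ?orbT.
Qed.

Lemma dist_open_bigU (I : Type) (F : I -> set T) :
  (forall i, dist_open (F i)) -> dist_open (\bigcup_i F i).
Proof.
move=> oF f [i _ Ff]; have [e e0 He] := oF i _ Ff.
by exists e => // g /He Fg; exists i.
Qed.

End open_for_distance.

(* D^0_K and S_I.  They are given the topology of d_K and d_I, which is the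
   intended one only when K and I are compact; it is used only for the
   restrictions to compact B and B_1.  Two total functions that agree on K
   are at distance 0, so this is the topology pulled back from the metric
   space of functions on K, with the same Borel sets and the same continuous
   functions. *)
Record D0_space (R : realType) (m : nat) (K : 'I_m.+1 -> set R) := D0Space {
  D0_fun :> 'rV[R]_m.+1 -> R;
  D0_funP : D0 K D0_fun }.

Record S_space (R : realType) (I : set R) := SSpace {
  S_fun :> R -> R;
  S_funP : calS_on I S_fun }.

Section spaces.
Variables (R : realType) (m : nat) (K : 'I_m.+1 -> set R) (I : set R).

HB.instance Definition _ := gen_eqMixin (D0_space K).
HB.instance Definition _ := gen_choiceMixin (D0_space K).
HB.instance Definition _ := gen_eqMixin (S_space I).
HB.instance Definition _ := gen_choiceMixin (S_space I).

Definition D0_dist (f g : D0_space K) := skorohod_dist K f g.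
Definition S_dist (f g : S_space I) := skorohod_dist1 I f g.

HB.instance Definition _ := isOpenTopological.Build (D0_space K)
  (dist_openT _) (@dist_openI _ _ D0_dist) (@dist_open_bigU _ _ D0_dist).
HB.instance Definition _ := isOpenTopological.Build (S_space I)
  (dist_openT _) (@dist_openI _ _ S_dist) (@dist_open_bigU _ _ S_dist).

End spaces.

Section restrictions.
Variable R : realType.

Lemma D0_sub m (B K : 'I_m.+1 -> set R) psi :
  subrectangle B K -> D0 K psi -> D0 B psi.
Proof.
move=> BK [a [V [ja cV Jpsi]]]; exists a, V; split => //.
- by move=> k; apply: continuous_subspaceW (cV k) => x Bx j; apply/BK/Bx.
- by move=> x Bx; apply: Jpsi => j; apply/BK/Bx.
Qed.

Lemma calS_on_sub (J I : set R) f : J `<=` I -> calS_on I f -> calS_on J f.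
Proof.
move=> JI [g Sg fg]; exists g => // t; rewrite inE => Jt.
by apply: fg; rewrite inE; exact: JI.
Qed.

Definition D0_restrict m (B K : 'I_m.+1 -> set R) (BK : subrectangle B K)
    (psi : D0_space K) : D0_space B := D0Space (D0_sub BK (D0_funP psi)).

Definition S_restrict (J I : set R) (JI : J `<=` I) (f : S_space I) :
  S_space J := SSpace (calS_on_sub JI (S_funP f)).

End restrictions.

Section maximizers.
Variables (R : realType) (d : nat).
Implicit Types (K : 'I_d -> set R) (f : 'rV[R]_d -> R) (x : 'rV[R]_d).

(* rho k = true stands for the sign +. *)
Definition quadrant K (rho : 'I_d -> bool) x : set 'rV[R]_d :=
  [set y | rect K y /\
     forall k, if rho k then x 0 k < y 0 k else y 0 k < x 0 k].

Definition quadrant_limit K f (rho : 'I_d -> bool) x (l : R) :=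
  quadrant K rho x !=set0 /\
  forall s : nat -> 'rV[R]_d, (forall n, quadrant K rho x (s n)) ->
    s n @[n --> \oo] --> x -> f (s n) @[n --> \oo] --> l.

Definition is_maximizer K f x :=
  rect K x /\
  ((f x)%:E = sup_on (rect K) f \/
   exists rho l, quadrant_limit K f rho x l /\ l%:E = sup_on (rect K) f).

(* Lexicographic minimality; k = 0 is the condition on the first coordinate. *)
Definition is_sargmax K f x :=
  is_maximizer K f x /\
  forall (k : 'I_d) xi, is_maximizer K f xi ->
    (forall j : 'I_d, (j < k)%N -> xi 0 j = x 0 j) -> x 0 k <= xi 0 k.

Definition is_largmax K f x :=
  is_maximizer K f x /\
  forall (k : 'I_d) xi, is_maximizer K f xi ->
    (forall j : 'I_d, (j < k)%N -> xi 0 j = x 0 j) -> xi 0 k <= x 0 k.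

(* Both take the junk value 0 when they are not well defined. *)
Definition sargmax K f : 'rV[R]_d := xget 0 (is_sargmax K f).
Definition largmax K f : 'rV[R]_d := xget 0 (is_largmax K f).

Definition argmaxes_defined K f :=
  (exists x, is_sargmax K f x) /\ (exists x, is_largmax K f x).

End maximizers.

Section random_elements.
Context {dO : measure_display} {Omega : measurableType dO} {R : realType}.
Variable P : probability Omega R.

Definition borel_measurable (T : topologicalType) (X : Omega -> T) :=
  forall A, <<s @open T >> A -> measurable (X @^-1` A).

(* For maps not known to be measurable, the library's integral of a
   nonnegative function is the lower integral; since h and M - h are both
   admissible, the condition then constrains lower and upper expectations. *)
Definition cvg_in_distribution (T : topologicalType)
    (X : nat -> Omega -> T) (X0 : Omega -> T) :=
  forall h : T -> R, continuous h -> (exists M : R, forall x, `|h x| <= M) ->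
    ('E_P[h \o X n] @[n --> \oo] --> 'E_P[h \o X0])%E.

(* For the sequence (X n) with n >= 1; the measurable cover A makes this a
   bound on the outer probability of [M < `|X n|]. *)
Definition bounded_in_probability (T : normedModType R)
    (X : nat -> Omega -> T) :=
  forall e : R, 0 < e -> exists M : R, forall n, (0 < n)%N ->
    exists A : set Omega, [/\ measurable A, (P A <= e%:E)%E &
                              [set w | M < `|X n w|] `<=` A].

End random_elements.

(* Main.v *)
Require Import Defs.
From mathcomp Require Import all_boot all_order all_algebra.
From mathcomp Require Import all_classical all_reals all_analysis.
From mathcomp Require Import measurable_realfun zify lra.

(* For phi continuous with 0 <= phi <= C and the pair am(y) of sargmax and largmax
   of y, let B = K n [-N, N]^d and consider the Lipschitz lower envelope
     g_{N,c}(x) = inf_y min(C, phi(am(y)) + c d(x, y|_B)),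
   y ranging over the pairs (psi, gamma) in form (J) on K whose argmaxes exist
   and have norm < N.  It is continuous on D^0_B x S_{B_1}, so (i) applies to
   it; it is a lower bound of phi(am(X_n)) on the event of (ii); and, am being
   continuous at X_0 along such pairs, g_{N,c}(X_0|_B) increases to
   phi(am(X_0)) as c -> oo for N large.  Hence phi(am(X_0)) is almost surely
   equal to a measurable function and liminf E phi(am(X_n)) >= E phi(am(X_0))
   for lower expectations; C - phi gives the other half.  Measurability of the
   argmaxes is never needed.

   Continuity of am at X_0: a maximizer lies over the closure of one piece of
   the partition of K_1 by the jumps.  When gamma is close to gamma_0 a time
   change carries the pieces of gamma_0 to those of gamma with the same index,
   and since the maxima of the V_j are distinct and uniquely attained, every
   maximizer of psi in B lies over the winning piece, with last coordinates
   near the unique maximizer of the winning V_j; sargmax and largmax have the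
   left and right ends of that piece as first coordinates. *)

Set Implicit Arguments.
Unset Strict Implicit.
Unset Printing Implicit Defensive.

Import Order.TTheory GRing.Theory Num.Theory.
Import numFieldNormedType.Exports.

Local Open Scope classical_set_scope.
Local Open Scope ring_scope.

(** * Lower integrals *)

Section lower_integral.
Context {dO : measure_display} {Omega : measurableType dO} {R : realType}.
Variable P : probability Omega R.
Local Open Scope ereal_scope.

Lemma cvge_near_ge (u : (\bar R)^nat) (l : \bar R) (e : R) :
  u @ \oo --> l -> l \is a fin_num -> (0 < e)%R ->
  \forall n \near \oo, l <= u n + e%:E.
Proof.
move=> ul; case: l ul => [l| |]// ul _ e0.
have hl : nbhs l%:E [set x : \bar R | (l - e)%:E < x].
  apply: open_nbhs_nbhs; split; first exact: open_ereal_gt_ereal.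
  by rewrite /= lte_fin ltrBlDr ltrDl.
near=> n; have : (l - e)%:E < u n by near: n; exact: (ul _ hl).
by case: (u n) => [r| |]//=; rewrite ?lte_fin ?lee_fin ?leey// ltrBlDr => /ltW.
Unshelve. all: by end_near. Qed.

(* The library's integral of a nonnegative function is a supremum over simple
   functions, hence monotone without any measurability. *)
Lemma le_lower_integral (f g : Omega -> R) :
  (forall w, 0 <= f w)%R -> (forall w, f w <= g w)%R ->
  \int[P]_w (f w)%:E <= \int[P]_w (g w)%:E.
Proof.
move=> f0 fg; rewrite !ge0_integralTE; first last.
- by move=> w; rewrite lee_fin.
- by move=> w; rewrite lee_fin (le_trans (f0 w)).
apply: le_ereal_sup => _ [s hs <-]; exists s => // w.
by rewrite (le_trans (hs w))// lee_fin.
Qed.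

Lemma integral_bounded_fin_num (f : Omega -> R) (C : R) :
  (forall w, 0 <= f w <= C)%R -> \int[P]_w (f w)%:E \is a fin_num.
Proof.
move=> fC; have f0 w : (0 <= f w)%R by case/andP: (fC w).
rewrite ge0_fin_numE; last by apply: integral_ge0 => w _; rewrite lee_fin.
apply: (@le_lt_trans _ _ (\int[P]_w (cst C w)%:E)).
  by apply: le_lower_integral => // w; case/andP: (fC w).
by rewrite (integral_cst P measurableT C%:E)/= probability_setT mule1 ltry.
Qed.

Lemma integral_indic_cst (C e : R) (A : set Omega) : (0 <= C)%R ->
  measurable A -> P A <= e%:E -> \int[P]_w (C * \1_A w)%:E <= (C * e)%:E.
Proof.
move=> C0 mA PA; under eq_integral do rewrite EFinM.
rewrite ge0_integralZl//; last exact/measurable_EFinP.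
by rewrite integral_indic// setIT EFinM lee_wpmul2l ?lee_fin.
Qed.

Lemma integralD_indic_le (F : Omega -> R) (C e : R) (A : set Omega) :
  (0 <= C)%R -> measurable A -> P A <= e%:E ->
  measurable_fun setT F -> (forall w, 0 <= F w)%R ->
  \int[P]_w (F w + C * \1_A w)%:E <= \int[P]_w (F w)%:E + (C * e)%:E.
Proof.
move=> C0 mA PA mF F0; under eq_integral do rewrite EFinD.
rewrite ge0_integralD//; first last.
- by apply/measurable_EFinP; exact: measurable_funM.
- by move=> w _; rewrite lee_fin mulr_ge0.
- exact/measurable_EFinP.
- by move=> w _; rewrite lee_fin.
by rewrite leeD2l// integral_indic_cst.
Qed.

(** For [f], whose measurability is unknown, only monotonicity is available; additivity is applied
    to the measurable majorant [G + C * \1_A]. *)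
Lemma lower_integral_le (f G : Omega -> R) (C e : R) (A : set Omega) :
  measurable A -> P A <= e%:E -> measurable_fun setT G ->
  (forall w, 0 <= G w)%R -> (forall w, 0 <= f w <= C)%R ->
  (forall w, ~ A w -> f w <= G w)%R ->
  \int[P]_w (f w)%:E <= \int[P]_w (G w)%:E + (C * e)%:E.
Proof.
move=> mA PA mG G0 fC fG.
have C0 : (0 <= C)%R.
  by have /andP[/le_trans h /h] := fC point.
apply: le_trans (integralD_indic_le C0 mA PA mG G0).
apply: le_lower_integral => [w|w]; first by case/andP: (fC w).
rewrite indicE; case: (boolP (w \in A)) => wA.
  by rewrite mulr1; case/andP: (fC w) => _ /le_trans; apply; rewrite lerDr.
by rewrite mulr0 addr0 fG// => /mem_set; exact/negP.
Qed.

(** Mirror of [lower_integral_le]: cutting [F] to zero on [A] gives a measurable function below [f]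
    everywhere, at a cost of at most [C * \1_A]. *)
Lemma lower_integral_ge (f F : Omega -> R) (C e : R) (A : set Omega) :
  measurable A -> P A <= e%:E -> measurable_fun setT F ->
  (forall w, 0 <= F w <= C)%R -> (forall w, 0 <= f w)%R ->
  (forall w, ~ A w -> F w <= f w)%R ->
  \int[P]_w (F w)%:E <= \int[P]_w (f w)%:E + (C * e)%:E.
Proof.
move=> mA PA mF FC f0 Ff.
have C0 : (0 <= C)%R by have /andP[/le_trans h /h] := FC point.
pose F' w : R := (F w * \1_(~` A) w)%R.
have F0 w : (0 <= F w)%R by case/andP: (FC w).
have mF' : measurable_fun setT F'.
  by apply: measurable_funM => //; apply: measurable_indic; exact: measurableC.
have F'0 w : (0 <= F' w)%R by rewrite /F' mulr_ge0.
apply: (@le_trans _ _ (\int[P]_w (F' w + C * \1_A w)%:E)).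
  apply: le_lower_integral => // w; rewrite /F' !indicE in_setC.
  case: (boolP (w \in A)) => wA /=; last by rewrite mulr1 mulr0 addr0.
  by rewrite mulr0 add0r mulr1; case/andP: (FC w).
apply: le_trans (integralD_indic_le C0 mA PA mF' F'0) _.
rewrite leeD2r//; apply: le_lower_integral => // w; rewrite /F' indicE in_setC.
case: (boolP (w \in A)) => wA /=; first by rewrite mulr0.
by rewrite mulr1 Ff// => /mem_set; exact/negP.
Qed.

(** One half of convergence, for [f] of unknown measurability: [F] is a measurable version of the
    limit [f 0], and [G] is a measurable function, below [f n] off a small set, whose integral falls
    short of that of [F] by at most [e]. This bounds the lower limit of the integrals; applied to
    [C - f] it bounds the upper limit. *)
Definition lower_approximable (C : R) (f : nat -> Omega -> R) :=
  exists F : Omega -> R, [/\ measurable_fun setT F,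
    forall w, (0 <= F w <= C)%R,
    {ae P, forall w, F w = f 0%N w} &
    forall e : R, (0 < e)%R -> \forall n \near \oo,
      exists (G : Omega -> R) (A : set Omega),
      [/\ measurable_fun setT G /\ (forall w, 0 <= G w <= C)%R,
          measurable A, P A <= e%:E,
          forall w, ~ A w -> (G w <= f n w)%R &
          \int[P]_w (F w)%:E <= \int[P]_w (G w)%:E + e%:E]].

Lemma lower_integral_ae (f F : Omega -> R) (C : R) :
  measurable_fun setT F -> (forall w, 0 <= F w <= C)%R ->
  (forall w, 0 <= f w <= C)%R -> {ae P, forall w, F w = f w} ->
  \int[P]_w (f w)%:E = \int[P]_w (F w)%:E.
Proof.
move=> mF FC fC [A [mA PA sA]].
have FfA w : ~ A w -> F w = f w by move=> nA; apply: contrapT => /sA.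
have PA0 : P A <= 0%R%:E by rewrite PA.
have le1 : \int[P]_w (f w)%:E <= \int[P]_w (F w)%:E + (C * 0)%:E.
  apply: lower_integral_le PA0 _ _ _ _ => //.
  + by move=> w; case/andP: (FC w).
  + by move=> w /FfA ->.
have le2 : \int[P]_w (F w)%:E <= \int[P]_w (f w)%:E + (C * 0)%:E.
  apply: lower_integral_ge PA0 _ _ _ _ => //.
  + by move=> w; case/andP: (fC w).
  + by move=> w /FfA ->.
by move: le1 le2; rewrite mulr0 !adde0 => le1 le2; apply/eqP; rewrite eq_le le1.
Qed.

Lemma integral_cstB (C : R) (F : Omega -> R) :
  measurable_fun setT F -> (forall w, 0 <= F w <= C)%R ->
  \int[P]_w (C - F w)%:E = C%:E - \int[P]_w (F w)%:E.
Proof.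
move=> mF FC; rewrite integralB_EFin//; first last.
- apply: measurable_bounded_integrable => //.
    by rewrite ltey_eq fin_num_measure.
  exists C; split; [exact: num_real|move=> x Cx w _ /=].
  rewrite ger0_norm; last by case/andP: (FC w).
  by rewrite (le_trans _ (ltW Cx))//; case/andP: (FC w).
- exact: finite_measure_integrable_cst.
by rewrite (integral_cst P measurableT C%:E)/= probability_setT mule1.
Qed.

(** The lower bound comes from [f] and the upper one from [C - f]: off [A'], [G' <= C - f n] reads
    [f n <= C - G']. *)
Lemma lower_approximable_cvg (C : R) (f : nat -> Omega -> R) :
  (forall n w, 0 <= f n w <= C)%R -> lower_approximable C f ->
  lower_approximable C (fun n w => C - f n w)%R ->
  \int[P]_w (f n w)%:E @[n --> \oo] --> \int[P]_w (f 0%N w)%:E.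
Proof.
move=> fC [F [mF FC Ff lF]] [F' [mF' F'C F'f lF']].
have C0 : (0 <= C)%R by have /andP[/le_trans h /h] := fC 0%N point.
have fin h : (forall w, 0 <= h w <= C)%R -> \int[P]_w (h w)%:E \is a fin_num.
  exact: integral_bounded_fin_num.
have CB h : (forall w, 0 <= h w <= C)%R -> (forall w, 0 <= (C - h w) <= C)%R.
  by move=> hC w; rewrite subr_ge0 lerBlDr lerDl; case/andP: (hC w) => -> ->.
(* [F] and [F'] are versions of [f 0] and [C - f 0], so they add up to [C] almost everywhere. *)
have FF' : \int[P]_w (F' w)%:E = C%:E - \int[P]_w (F w)%:E.
  rewrite -integral_cstB//.
  apply: ae_eq_integral => //; [exact/measurable_EFinP| |].
    by apply/measurable_EFinP; exact: measurable_funB.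
  by apply: filterS2 Ff F'f => w -> -> _.
rewrite (lower_integral_ae mF FC (fC 0%N) Ff) -(fineK (fin _ FC)).
apply/fine_cvgP; split; first by apply: nearW => n; exact: fin.
apply/cvgrPdist_le => e e0.
(* Each half loses [e / (1 + C)] in the integrals and [C] times as much on the exceptional set,
   which makes [e] in all. *)
have C1 : (0 < 1 + C)%R by rewrite ltr_pwDl.
have e'0 : (0 < e / (1 + C))%R by rewrite divr_gt0.
have /= lF0 := lF _ e'0; have /= lF'0 := lF' _ e'0.
near=> n.
have [G [A [[mG GC] mA PA GF FG]]] : exists (G : Omega -> R) (A : set Omega),
    [/\ measurable_fun setT G /\ (forall w, 0 <= G w <= C)%R,
      measurable A, P A <= (e / (1 + C))%:E, forall w, ~ A w -> (G w <= f n w)%R &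
      \int[P]_w (F w)%:E <= \int[P]_w (G w)%:E + (e / (1 + C))%:E].
  by near: n.
have [G' [A' [[mG' G'C] mA' PA' GF' FG']]] :
    exists (G : Omega -> R) (A : set Omega),
    [/\ measurable_fun setT G /\ (forall w, 0 <= G w <= C)%R,
      measurable A, P A <= (e / (1 + C))%:E, forall w, ~ A w -> (G w <= C - f n w)%R &
      \int[P]_w (F' w)%:E <= \int[P]_w (G w)%:E + (e / (1 + C))%:E].
  by near: n.
have Ee : (e = e / (1 + C) + C * (e / (1 + C)))%R.
  by rewrite -[X in (X + _)%R]mul1r -mulrDl mulrC divfK// gt_eqF.
have f0 w : (0 <= f n w)%R by case/andP: (fC n w).
have := lower_integral_ge mA PA mG GC f0 GF.
have CG'0 w : (0 <= C - G' w)%R by case/andP: (CB _ _ G'C w).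
have mCG' : measurable_fun setT (fun w => C - G' w)%R by exact: measurable_funB.
have := lower_integral_le mA' PA' mCG'.
move=> /(_ (f n) C CG'0 (fC n)).
have fG' w : ~ A' w -> (f n w <= C - G' w)%R.
  by move=> /GF'; rewrite !lerBrDr addrC.
move=> /(_ fG'); rewrite integral_cstB//.
move: FG FG'; rewrite FF'.
move: (fin _ FC) (fin _ GC) (fin _ G'C) (fin _ (fC n)).
move: (\int[P]_w (F w)%:E) (\int[P]_w (G w)%:E) (\int[P]_w (G' w)%:E)
  (\int[P]_w (f n w)%:E) => [x| |]// [y| |]// [z| |]// [t| |]// _ _ _ _ /=.
move: Ee; set e' := (e / (1 + C))%R; set e'' := (C * e')%R => Ee.
rewrite -?EFinN -?EFinD !lee_fin ler_norml => *; lra.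
Unshelve. all: by end_near. Qed.
End lower_integral.

(** * Limits of a family of lower bounds *)

Section envelopes.
Context {dO : measure_display} {Omega : measurableType dO} {R : realType}.
Variable P : probability Omega R.
Local Open Scope ereal_scope.

Lemma bounded_cvg_integral (C : R) (u : nat -> Omega -> R) (v : Omega -> R) :
  (forall n, measurable_fun setT (u n)) -> measurable_fun setT v ->
  (forall n w, 0 <= u n w <= C)%R ->
  {ae P, forall w, u n w @[n --> \oo] --> v w} ->
  \int[P]_w (u n w)%:E @[n --> \oo] --> \int[P]_w (v w)%:E.
Proof.
move=> mu mv uC uv.
have mu' n : measurable_fun setT (fun w => (u n w)%:E) by exact/measurable_EFinP.
have mv' : measurable_fun setT (EFin \o v) by exact/measurable_EFinP.
have uv' : {ae P, forall w, setT w -> (u n w)%:E @[n --> \oo] --> (v w)%:E}.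
  by apply: filterS uv => w uv _; apply/cvg_EFin => //; exact: nearW.
have iC : P.-integrable setT (EFin \o cst C).
  exact: finite_measure_integrable_cst.
have uC' : {ae P, forall w n, setT w -> `|(u n w)%:E| <= (EFin \o cst C) w}.
  apply: aeW => w n _ /=; have /andP[? ?] := uC n w.
  by rewrite lee_fin ger0_norm.
by have [] := dominated_convergence measurableT mu' mv' uv' iC uC'.
Qed.

(** At index 0, [c] tends to infinity first and then [N], which produces [F]. For a given error one
    fixes [N], then [c], and only then lets [n] grow, so that [g_cvg] is applied at fixed [N] and
    [c]. *)
Lemma envelopes_lower_approximable (C : R) (f : nat -> Omega -> R)
    (g : nat -> nat -> nat -> Omega -> R) :
  (forall N c n, measurable_fun setT (g N c n)) ->
  (forall N c n w, 0 <= g N c n w <= C)%R ->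
  (forall N n w, nondecreasing_seq (fun c => g N c n w)) ->
  (forall N c, \int[P]_w (g N c n w)%:E @[n --> \oo] --> \int[P]_w (g N c 0%N w)%:E) ->
  (forall e : R, (0 < e)%R -> \forall N \near \oo, forall n, (0 < n)%N ->
     exists A, [/\ measurable A, P A <= e%:E &
       forall c w, ~ A w -> (g N c n w <= f n w)%R]) ->
  {ae P, forall w, \forall N \near \oo, g N c 0%N w @[c --> \oo] --> f 0%N w} ->
  lower_approximable P C f.
Proof.
move=> mg gC g_nd g_cvg g_low g_lim.
pose FN N w : R := limn (fun c => g N c 0%N w).
have FNcvg N w : g N c 0%N w @[c --> \oo] --> FN N w.
  apply: nondecreasing_is_cvgn; first exact: g_nd.
  by exists C => _ [c _ <-]; case/andP: (gC N c 0%N w).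
have FNC N w : (0 <= FN N w <= C)%R.
  apply/andP; split.
    apply: limr_ge; [exact: FNcvg|apply: nearW => c].
    by case/andP: (gC N c 0%N w).
  apply: limr_le; [exact: FNcvg|apply: nearW => c].
  by case/andP: (gC N c 0%N w).
have mFN N : measurable_fun setT (FN N).
  by apply: (@measurable_fun_cvg _ _ _ _ (fun c => g N c 0%N)) => // w _; exact: FNcvg.
have FNub w : has_ubound (range (FN ^~ w)).
  by exists C => _ [N _ <-]; case/andP: (FNC N w).
have FNlb w : has_lbound (range (FN ^~ w)).
  by exists 0%R => _ [N _ <-]; case/andP: (FNC N w).
(* The limit in [N] is known almost surely only; the upper limit is measurable everywhere, and
   clipping gives the bounds at every [w]. *)
pose F' w : R := limn_sup (FN ^~ w).
pose F w : R := Num.max 0%R (Num.min C (F' w)).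
have C0 : (0 <= C)%R by have /andP[/le_trans h /h] := gC 0%N 0%N 0%N point.
have FC w : (0 <= F w <= C)%R.
  by rewrite /F le_max lexx/= ge_max C0/= ge_min lexx.
have mF : measurable_fun setT F.
  apply: measurable_maxr => //; apply: measurable_minr => //.
  exact: measurable_fun_limn_sup.
have FN_lim : {ae P, forall w, FN N w @[N --> \oo] --> f 0%N w}.
  apply: filterS g_lim => w [N0 _ hN]; apply: cvg_near_cst.
  by exists N0 => // N /hN /cvg_lim; exact.
have Ff : {ae P, forall w, F w = f 0%N w}.
  apply: filterS FN_lim => w FNf.
  have fC : (0 <= f 0%N w <= C)%R.
    apply/andP; split.
      rewrite -(cvg_lim _ FNf)//; apply: limr_ge; first exact: (cvgP _ FNf).
      by apply: nearW => N; case/andP: (FNC N w).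
    rewrite -(cvg_lim _ FNf)//; apply: limr_le; first exact: (cvgP _ FNf).
    by apply: nearW => N; case/andP: (FNC N w).
  have F'E : F' w = f 0%N w by apply: cvg_lim => //; exact: cvg_sups.
  rewrite /F F'E; case/andP: fC => f0 fC.
  by rewrite (min_idPr fC) (max_idPr f0).
exists F; split => // e e0.
(* One third for each of [N], [c] and [n], chosen in this order. *)
have e30 : (0 < e / 3)%R by rewrite divr_gt0.
have fin h : (forall w, 0 <= h w <= C)%R -> \int[P]_w (h w)%:E \is a fin_num.
  exact: integral_bounded_fin_num.
have cvgF : \int[P]_w (FN N w)%:E @[N --> \oo] --> \int[P]_w (F w)%:E.
  by apply: bounded_cvg_integral => //; apply: filterS2 FN_lim Ff => w + ->.
have [N [hN lowN]] : exists N, \int[P]_w (F w)%:E <= \int[P]_w (FN N w)%:E + (e / 3)%:E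
   /\ forall n, (0 < n)%N ->
     exists A, [/\ measurable A, P A <= e%:E &
       forall c w, ~ A w -> (g N c n w <= f n w)%R].
  have [N [? ?]] := filter_ex (filterI (cvge_near_ge cvgF (fin _ FC) e30) (g_low _ e0)).
  by exists N.
have cvgFN : \int[P]_w (g N c 0%N w)%:E @[c --> \oo] --> \int[P]_w (FN N w)%:E.
  by apply: bounded_cvg_integral => //; apply: aeW => w; exact: FNcvg.
have [c hc] := filter_ex (cvge_near_ge cvgFN (fin _ (FNC N)) e30).
near=> n.
have hn : \int[P]_w (g N c 0%N w)%:E <= \int[P]_w (g N c n w)%:E + (e / 3)%:E.
  near: n; apply: cvge_near_ge => //; exact: fin.
have n0 : (0 < n)%N by near: n; exists 1%N.
have [A [mA PA gA]] := lowN _ n0.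
exists (g N c n), A; split => //; first by move=> w /gA.
apply: le_trans hN _; apply: le_trans (leeD2r _ hc) _.
apply: le_trans (leeD2r _ (leeD2r _ hn)) _.
move: (\int[P]_w (g N c n w)%:E) => x.
by rewrite -!addeA leeD2l// -!EFinD lee_fin; lra.
Unshelve. all: by end_near. Qed.
End envelopes.

(** * Lipschitz lower envelopes *)

Section lower_envelope.
Context {R : realType} {T : topologicalType} {I : Type}.
Variables (C : R) (S : set I) (h : I -> R) (d : T -> I -> R).
Hypothesis C0 : 0 <= C.
Hypothesis h0 : forall i, 0 <= h i.
Hypothesis d0 : forall x i, 0 <= d x i.

(** A Pasch-Hausdorff envelope of [h] on [S]. The element [C] caps it and keeps the set nonempty
    when [S] is empty. *)
Definition lower_envelope (c : R) (x : T) : R :=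
  inf [set z | z = C \/ exists2 i, S i & z = h i + c * d x i].

Let E c x := [set z | z = C \/ exists2 i, S i & z = h i + c * d x i].

Let E_lb c x : 0 <= c -> lbound (E c x) 0.
Proof. by move=> c0 _ [->//|[i Si ->]]; rewrite addr_ge0// mulr_ge0. Qed.

Let E_nonempty c x : E c x !=set0. Proof. by exists C; left. Qed.

Lemma lower_envelope_bounds c x : 0 <= c -> 0 <= lower_envelope c x <= C.
Proof.
move=> c0; apply/andP; split; first by apply: lb_le_inf; [exact: E_nonempty|exact: E_lb].
by apply: ge_inf; [exists 0; exact: E_lb|left].
Qed.

Lemma lower_envelope_le c x i : 0 <= c -> S i ->
  lower_envelope c x <= h i + c * d x i.
Proof. by move=> c0 Si; apply: ge_inf; [exists 0; exact: E_lb|right; exists i]. Qed.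

Lemma lower_envelope_ge c x (z : R) : z <= C ->
  (forall i, S i -> z <= h i + c * d x i) -> z <= lower_envelope c x.
Proof.
move=> zC zh; apply: lb_le_inf; first exact: E_nonempty.
by move=> _ [->//|[i Si ->]]; exact: zh.
Qed.

Lemma lower_envelope_nondecreasing x (c c' : R) : 0 <= c -> c <= c' ->
  lower_envelope c x <= lower_envelope c' x.
Proof.
move=> c0 cc'; apply: lower_envelope_ge.
  by case/andP: (lower_envelope_bounds x c0).
move=> i Si; apply: le_trans (lower_envelope_le x c0 Si) _.
by rewrite lerD2l ler_wpM2r.
Qed.

(** An infimum of functions of [x] that are equicontinuous uniformly in [i] inherits their common
    modulus. *)
Lemma lower_envelope_continuous c : 0 <= c ->
  (forall x e, 0 < e -> \forall x' \near x, forall i, `|d x i - d x' i| <= e) ->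
  continuous (lower_envelope c).
Proof.
move=> c0 dC x; apply/cvgrPdist_le => e e0.
(* [c + 1] in place of [c], which may be 0. *)
have c1 : 0 < c + 1 by rewrite ltr_pwDr.
have e'0 : 0 < e / (c + 1) by rewrite divr_gt0.
near=> x'.
have dx' i : `|d x i - d x' i| <= e / (c + 1) by move: i; near: x'; exact: dC.
have ce : c * (e / (c + 1)) <= e.
  by rewrite mulrCA ger_pMr// ler_pdivrMr// mul1r lerDl.
have key y y' : (forall i, d y' i <= d y i + e / (c + 1)) ->
    lower_envelope c y' - e <= lower_envelope c y.
  move=> yy'; apply: lower_envelope_ge.
    by rewrite lerBlDr (le_trans (proj2 (andP (lower_envelope_bounds y' c0))))// lerDl ltW.
  move=> i Si; rewrite lerBlDr (le_trans (lower_envelope_le y' c0 Si))//.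
  rewrite -addrA lerD2l; apply: (le_trans (ler_wpM2l c0 (yy' i))).
  by rewrite mulrDr lerD2l.
rewrite ler_norml; apply/andP; split.
  rewrite lerNl opprB lerBlDr -lerBlDl; apply: key => i.
  by have := dx' i; rewrite ler_norml => /andP[? ?]; lra.
rewrite lerBlDr -lerBlDl; apply: key => i.
by have := dx' i; rewrite ler_norml => /andP[? ?]; lra.
Unshelve. all: by end_near. Qed.

(** The index at distance 0 keeps the envelope at most [v]. An index closer than [del] has [h i] at
    least [v - e] by lower semicontinuity, and a farther one is penalised by [n * del], which
    eventually exceeds [v]. *)
Lemma lower_envelope_cvg x (v : R) :
  0 <= v <= C -> (exists2 i, S i & d x i = 0 /\ h i = v) ->
  (forall e, 0 < e -> exists2 del, 0 < del &
     forall i, S i -> d x i < del -> v - e <= h i) ->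
  lower_envelope n%:R x @[n --> \oo] --> v.
Proof.
move=> /andP[v0 vC] [i0 Si0 [di0 hi0]] lsc; apply/cvgrPdist_le => e e0.
have [del del0 hdel] := lsc _ e0.
near=> n.
have n0 : (0 : R) <= n%:R by [].
have nv : v <= n%:R * del.
  rewrite -ler_pdivrMr//; near: n; exact: nbhs_infty_ger.
rewrite ger0_norm; last first.
  by have := lower_envelope_le x n0 Si0; rewrite di0 hi0 mulr0 addr0 subr_ge0.
rewrite lerBlDr -lerBlDl; apply: lower_envelope_ge; first by lra.
move=> i Si; have [/(hdel _ Si) vh|ddel] := ltP (d x i) del.
  by rewrite (le_trans vh)// lerDl mulr_ge0.
apply: (@le_trans _ _ (n%:R * del)); first lra.
by apply: le_trans (_ : n%:R * d x i <= _); [rewrite ler_wpM2l|rewrite lerDr].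
Unshelve. all: by end_near. Qed.
End lower_envelope.

(** * The Skorohod distance *)

Section time_changes.
Context {R : realType}.
Implicit Types (I : set R) (l : R -> R).

Lemma time_change_lt I l s t : time_change I l -> I s -> I t -> s < t -> l s < l t.
Proof. by case=> + _ Is It; apply; rewrite inE. Qed.

Lemma time_change_in I l t : time_change I l -> I t -> I (l t).
Proof. by case=> _ lI It; rewrite -lI; exists t. Qed.

Lemma time_change_surj I l t : time_change I l -> I t -> exists2 s, I s & l s = t.
Proof. by case=> _ lI It; move: (It); rewrite -[X in X t]lI => -[s Is <-]; exists s. Qed.

Lemma time_change_inj I l s t : time_change I l -> I s -> I t -> l s = l t -> s = t.
Proof.
move=> tl Is It lst; case: (ltgtP s t) => // st.
- by have := time_change_lt tl Is It st; rewrite lst ltxx.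
- by have := time_change_lt tl It Is st; rewrite lst ltxx.
Qed.

Lemma time_change_slope_gt0 I l s t : time_change I l -> I s -> I t -> s != t ->
  0 < (l t - l s) / (t - s).
Proof.
move=> tl Is It; rewrite neq_lt => /orP[st|ts].
  by rewrite divr_gt0// subr_gt0//; exact: (time_change_lt tl).
by rewrite -mulrNN -invrN !opprB divr_gt0// subr_gt0//; exact: (time_change_lt tl).
Qed.

Lemma time_change_id I : time_change I id.
Proof. by split => //; rewrite image_id. Qed.

Lemma time_change_comp I l l' :
  time_change I l -> time_change I l' -> time_change I (l' \o l).
Proof.
move=> tl tl'; split; last by rewrite -image_comp; case: tl => _ ->; case: tl'.
move=> s t; rewrite !inE => Is It st /=.
by apply: (time_change_lt tl');
  [exact: (time_change_in tl)|exact: (time_change_in tl)|exact: (time_change_lt tl)].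
Qed.

Lemma time_change_inv I l : time_change I l ->
  exists l', [/\ time_change I l', forall t, I t -> l (l' t) = t &
                 forall t, I t -> l' (l t) = t].
Proof.
move=> tl; pose l' t := xget 0 [set s | I s /\ l s = t].
have l'P t : I t -> I (l' t) /\ l (l' t) = t.
  by move=> It; have [s Is lst] := time_change_surj tl It;
    apply: (@xgetPex _ 0 [set s | I s /\ l s = t]); exists s.
have l'K t : I t -> l' (l t) = t.
  move=> It; have [Il' ll'] := l'P _ (time_change_in tl It).
  exact: (time_change_inj tl).
exists l'; split => //; last by move=> t /l'P[].
split.
  move=> s t; rewrite !inE => Is It st.
  have [Is' ls] := l'P _ Is; have [It' lt] := l'P _ It.
  rewrite ltNge; apply/negP; rewrite le_eqVlt => /orP[/eqP ll|ll].
    by move: st; rewrite -ls -lt ll ltxx.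
  by have := time_change_lt tl It' Is' ll; rewrite ls lt => /(lt_trans st); rewrite ltxx.
apply/seteqP; split => [_ [t It <-]|t It]; first by have [] := l'P _ It.
by exists (l t); [exact: (time_change_in tl)|exact: l'K].
Qed.

Lemma log_slope_leP I l (a : R) :
  (log_slope I l <= a%:E)%E <->
  forall s t, I s -> I t -> s != t -> `|ln ((l t - l s) / (t - s))| <= a.
Proof.
split=> [h s t Is It st|h].
  rewrite -lee_fin; apply: le_trans h; apply: ereal_sup_ubound.
  by exists s, t.
by apply: ge_ereal_sup => _ [s [t [Is It st ->]]]; rewrite lee_fin h.
Qed.

End time_changes.

Section skorohod_distance_theory.
Context {R : realType} {n : nat}.
Variable B : 'I_n -> set R.
Implicit Types (f g h : 'rV[R]_n -> R).

(** Separate real bounds for the time change ([a]) and for the values ([b]): unlike the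
    extended-real infimum, these compose and invert explicitly. *)
Definition skorohod_close (a b : R) f g (l : 'I_n -> R -> R) :=
  [/\ forall k, time_change (B k) (l k),
      forall k, (log_slope (B k) (l k) <= a%:E)%E &
      forall x, rect B x -> `|f x - g (act l x)| <= b].

Lemma skorohod_dist_le a b f g l : 0 <= a ->
  skorohod_close a b f g l -> (skorohod_dist B f g <= (a + b)%:E)%E.
Proof.
move=> a0 [tl la fg].
apply: ge_ereal_inf; eexists; first by exists l => //.
rewrite EFinD; apply: leeD; first by apply: bigmax_le => //; rewrite lee_fin.
by apply: ge_ereal_sup => _ [x Bx <-]; rewrite lee_fin fg.
Qed.

Lemma sup_on_norm_ge0 f g l : rect B !=set0 ->
  (0 <= sup_on (rect B) (fun x => `|f x - g (act l x)|)%R)%E.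
Proof.
move=> [x Bx]; apply: (@le_trans _ _ (`|f x - g (act l x)|%:E)).
  by rewrite lee_fin.
by apply: ereal_sup_ubound; exists x.
Qed.

(** Over a nonempty rectangle the supremum of the norms is nonnegative; both summands are then
    nonnegative with a finite sum, hence real. *)
Lemma skorohod_dist_lt (e : R) f g : rect B !=set0 ->
  (skorohod_dist B f g < e%:E)%E ->
  exists a b l, [/\ 0 <= a, 0 <= b, a + b < e & skorohod_close a b f g l].
Proof.
move=> B0 /ereal_inf_lt[_ [l tl ->]].
set A := (\big[_/_]_k _)%E; set S := sup_on _ _ => AS.
have A0 : (0 <= A)%E by apply: bigmax_ge_id.
have S0 : (0 <= S)%E by exact: sup_on_norm_ge0.
have lA k : (log_slope (B k) (l k) <= A)%E.
  by rewrite /A; exact: (le_bigmax _ (fun k => log_slope (B k) (l k))).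
have fS x : rect B x -> ((`|f x - g (act l x)|)%:E <= S)%E.
  by move=> Bx; apply: ereal_sup_ubound; exists x.
move: A S A0 S0 lA fS AS => [a| |]// [b| |]// A0 S0 lA fS AS.
by exists a, b, l; split; rewrite -?lee_fin -?lte_fin//.
Qed.

Lemma skorohod_dist_ge0 f g : rect B !=set0 -> (0 <= skorohod_dist B f g)%E.
Proof.
move=> B0; apply: le_ereal_inf_tmp => _ [l tl ->].
by rewrite adde_ge0 ?sup_on_norm_ge0//; exact: bigmax_ge_id.
Qed.

Lemma act_rect l x : (forall k, time_change (B k) (l k)) -> rect B x -> rect B (act l x).
Proof. by move=> tl Bx k; rewrite mxE; exact: (time_change_in (tl k)). Qed.

Lemma skorohod_dist_refl f : rect B !=set0 -> skorohod_dist B f f = 0%E.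
Proof.
move=> B0; apply/eqP; rewrite eq_le skorohod_dist_ge0// andbT.
have -> : (0 : \bar R)%E = (0 + 0)%:E by rewrite addr0.
apply: (@skorohod_dist_le _ _ _ _ (fun=> id)) => //; split.
- by move=> k; exact: time_change_id.
- by move=> k; apply/log_slope_leP => s t _ _ st; rewrite divff ?ln1 ?normr0// subr_eq0 eq_sym.
- move=> x _; rewrite (_ : act _ _ = x) ?subrr ?normr0//.
  by apply/rowP => k; rewrite mxE.
Qed.

(** Inverting the time change inverts its slopes, which leaves the absolute value of their
    logarithms unchanged. *)
Lemma skorohod_close_sym a b f g l : skorohod_close a b f g l ->
  exists l', skorohod_close a b g f l'.
Proof.
move=> [tl la fg].
have /choice[l' l'P] := fun k => time_change_inv (tl k).
exists l'; split.
- by move=> k; have [] := l'P k.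
- move=> k; have [tl' ll' l'l] := l'P k; apply/log_slope_leP => s t Is It st.
  have [Is' It'] := (time_change_in tl' Is, time_change_in tl' It).
  have st' : l' k s != l' k t.
    by apply: contra_neq st => st'; rewrite -(ll' _ Is) -(ll' _ It) st'.
  have /log_slope_leP := la k => /(_ _ _ Is' It' st').
  rewrite !ll'// -(invrK ((l' k t - l' k s) / (t - s))) invf_div lnV ?normrN//.
  by rewrite posrE -[in X in 0 < X / _](ll' _ It) -[in X in 0 < X / _](ll' _ Is);
     exact: (time_change_slope_gt0 (tl k)).
- move=> x Bx; have Bx' : rect B (act l' x).
    by apply: act_rect => // k; have [] := l'P k.
  have := fg _ Bx'; rewrite distrC (_ : act l _ = x)//.
  by apply/rowP => k; rewrite !mxE; have [_ -> //] := l'P k.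
Qed.

Lemma skorohod_dist_sym f g : rect B !=set0 ->
  skorohod_dist B f g = skorohod_dist B g f.
Proof.
move=> B0; suff le f' g' : (skorohod_dist B f' g' <= skorohod_dist B g' f')%E.
  by apply/eqP; rewrite eq_le !le.
have := skorohod_dist_ge0 g' f' B0; case E : (skorohod_dist B g' f') => [r| |]// _;
  last by rewrite leey.
apply/lee_addgt0Pr => e e0.
have [|a [b [l [a0 b0 ab /skorohod_close_sym[l' gf]]]]] :=
    @skorohod_dist_lt (r + e) g' f' B0.
  by rewrite E lte_fin ltrDl.
by apply: le_trans (skorohod_dist_le a0 gf) _; rewrite -EFinD lee_fin ltW.
Qed.

(** Slopes of a composition multiply, so their logarithms add. *)
Lemma skorohod_close_trans a b a' b' f g h l l' :
  skorohod_close a b f g l -> skorohod_close a' b' g h l' ->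
  skorohod_close (a + a') (b + b') f h (fun k => l' k \o l k).
Proof.
move=> [tl la fg] [tl' la' gh]; split.
- by move=> k; exact: time_change_comp.
- move=> k; apply/log_slope_leP => s t Is It st.
  have [Is' It'] := (time_change_in (tl k) Is, time_change_in (tl k) It).
  have st' : l k s != l k t.
    by apply: contra_neq st => st'; exact: (time_change_inj (tl k)) st'.
  have /log_slope_leP/(_ _ _ Is It st) h1 := la k.
  have /log_slope_leP/(_ _ _ Is' It' st') h2 := la' k.
  have -> : (l' k \o l k) t - (l' k \o l k) s =
      (l' k (l k t) - l' k (l k s)) / (l k t - l k s) * (l k t - l k s).
    by rewrite divfK// subr_eq0 eq_sym.
  rewrite -mulrA lnM ?posrE; first last.
  + exact: (time_change_slope_gt0 (tl k)).
  + exact: (time_change_slope_gt0 (tl' k)).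
  by rewrite addrC (le_trans (ler_normD _ _))// lerD.
- move=> x Bx; rewrite -(subrKA (g (act l x))) (le_trans (ler_normD _ _))// lerD//.
    exact: fg.
  rewrite (_ : act (fun k => l' k \o l k) x = act l' (act l x)).
    by apply: gh; exact: act_rect.
  by apply/rowP => k; rewrite !mxE.
Qed.

Lemma skorohod_dist_triangle f g h : rect B !=set0 ->
  (skorohod_dist B f h <= skorohod_dist B f g + skorohod_dist B g h)%E.
Proof.
move=> B0.
have := skorohod_dist_ge0 f g B0; case E : (skorohod_dist B f g) => [r| |]// _;
  have := skorohod_dist_ge0 g h B0; case E' : (skorohod_dist B g h) => [r'| |]// _;
  rewrite ?leey//.
apply/lee_addgt0Pr => e e0.
have [|a [b [l [a0 b0 ab fg]]]] := @skorohod_dist_lt (r + e / 2) f g B0.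
  by rewrite E lte_fin ltrDl divr_gt0.
have [|a' [b' [l' [a'0 b'0 ab' gh]]]] := @skorohod_dist_lt (r' + e / 2) g h B0.
  by rewrite E' lte_fin ltrDl divr_gt0.
apply: le_trans (skorohod_dist_le _ (skorohod_close_trans fg gh)) _.
  by rewrite addr_ge0.
by rewrite -!EFinD lee_fin; lra.
Qed.

End skorohod_distance_theory.

(** * Truncated product distance and its neighbourhoods *)

Section truncation.
Context {R : realType}.
Local Open Scope ereal_scope.

(** The Skorohod distance may be [+oo]; capping it at 1 makes it real and keeps the small balls. *)
Definition trunc (x : \bar R) : R := fine (mine x 1).

Lemma trunc_fin (x : \bar R) : 0 <= x -> mine x 1 \is a fin_num.
Proof.
move=> x0; rewrite fin_numE; apply/andP; split.
  by rewrite gt_eqF// lt_min !ltNyr andbT (lt_le_trans _ x0)// ltNyr.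
by rewrite lt_eqF// gt_min ltry orbT.
Qed.

Lemma trunc_ge0 (x : \bar R) : 0 <= x -> (0 <= trunc x)%R.
Proof. by move=> x0; rewrite fine_ge0// le_min x0 lee01. Qed.

Lemma trunc_lip (x x' : \bar R) (e : R) : 0 <= x -> 0 <= x' -> (0 <= e)%R ->
  x <= x' + e%:E -> (trunc x <= trunc x' + e)%R.
Proof.
move=> x0 x'0 e0 xx'; rewrite -lee_fin EFinD /trunc !fineK ?trunc_fin//.
have [x'1|x'1] := leP x' 1; first by rewrite ge_min xx'.
rewrite (@le_trans _ _ 1)// ?ge_min ?lexx ?orbT//.
by rewrite leeDl// lee_fin.
Qed.

Lemma trunc_lt (x : \bar R) (e : R) : 0 <= x -> (e <= 1)%R ->
  (trunc x < e)%R -> x < e%:E.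
Proof.
move=> x0 e1; rewrite -lte_fin /trunc fineK ?trunc_fin// gt_min => /orP[//|].
by rewrite lte_fin ltNge e1.
Qed.

Lemma trunc0 : trunc 0 = 0%R.
Proof. by rewrite /trunc min_l// lee01. Qed.

End truncation.

Section product_distance.
Context {R : realType} {m : nat}.
Variables (B : 'I_m.+1 -> set R) (I : set R).
Hypothesis B0 : rect B !=set0.
Hypothesis I0 : I !=set0.
Local Open Scope ereal_scope.

Lemma rect1_nonempty : rect (fun _ : 'I_1 => I) !=set0.
Proof. by have [t It] := I0; exists (const_mx t) => k; rewrite mxE. Qed.
Let J0 := rect1_nonempty.

(** The open sets are those of [dist_open]; that balls are among them is the triangle inequality. *)
Lemma nbhs_D0_dist (f : D0_space B) (e : R) : (0 < e)%R ->
  nbhs f [set g | D0_dist f g < e%:E].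
Proof.
move=> e0; apply: open_nbhs_nbhs; split; last first.
  by rewrite /= /D0_dist skorohod_dist_refl// lte_fin.
move=> g /= fg; have := skorohod_dist_ge0 f g B0.
rewrite /D0_dist in fg *; move: fg.
case E : (skorohod_dist B f g) => [r| |]// re _; rewrite lte_fin in re.
exists (e - r)%R; first by rewrite subr_gt0.
move=> h gh; apply: le_lt_trans (skorohod_dist_triangle f g h B0) _.
by rewrite E -lteBrDl// -EFinB.
Qed.

Lemma nbhs_S_dist (f : S_space I) (e : R) : (0 < e)%R ->
  nbhs f [set g | S_dist f g < e%:E].
Proof.
move=> e0; apply: open_nbhs_nbhs; split; last first.
  by rewrite /= /S_dist /skorohod_dist1 skorohod_dist_refl// lte_fin.
move=> g /= fg; rewrite /S_dist /skorohod_dist1 in fg *.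
have := skorohod_dist_ge0 (fun x => f (x 0 0))%R (fun x => g (x 0 0))%R J0; move: fg.
case E : (skorohod_dist _ _ _) => [r| |]// re _; rewrite lte_fin in re.
exists (e - r)%R; first by rewrite subr_gt0.
move=> h gh; apply: le_lt_trans (skorohod_dist_triangle _ (fun x => g (x 0 0))%R _ J0) _.
by rewrite E -lteBrDl// -EFinB.
Qed.

Definition pair_dist (x y : D0_space B * S_space I) : R :=
  (trunc (D0_dist x.1 y.1) + trunc (S_dist x.2 y.2))%R.

Lemma D0_dist_ge0 (f g : D0_space B) : 0 <= D0_dist f g.
Proof. exact: skorohod_dist_ge0. Qed.

Lemma S_dist_ge0 (f g : S_space I) : 0 <= S_dist f g.
Proof. exact: skorohod_dist_ge0. Qed.

Lemma pair_dist_ge0 x y : (0 <= pair_dist x y)%R.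
Proof. by rewrite addr_ge0// trunc_ge0// ?D0_dist_ge0 ?S_dist_ge0. Qed.

Lemma pair_dist_refl x : pair_dist x x = 0%R.
Proof.
by rewrite /pair_dist /D0_dist /S_dist /skorohod_dist1 !skorohod_dist_refl// trunc0 addr0.
Qed.

Lemma pair_dist_lt x y (e : R) : (e <= 1)%R -> (pair_dist x y < e)%R ->
  D0_dist x.1 y.1 < e%:E /\ S_dist x.2 y.2 < e%:E.
Proof.
move=> e1 xy; split; apply: trunc_lt; rewrite ?D0_dist_ge0 ?S_dist_ge0//;
  apply: le_lt_trans xy; rewrite /pair_dist ?lerDl ?lerDr trunc_ge0//
    ?D0_dist_ge0 ?S_dist_ge0//.
Qed.

(** The uniformity in [y] is what [lower_envelope_continuous] asks for; it comes from the triangle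
    inequality in the first argument. *)
Lemma pair_dist_near (x : D0_space B * S_space I) (e : R) : (0 < e)%R ->
  \forall x' \near x, forall y, (`|pair_dist x y - pair_dist x' y| <= e)%R.
Proof.
move=> e0; have e20 : (0 < e / 2)%R by rewrite divr_gt0.
exists ([set g | D0_dist x.1 g < (e / 2)%:E], [set g | S_dist x.2 g < (e / 2)%:E]).
  by split; [exact: nbhs_D0_dist|exact: nbhs_S_dist].
move=> x' /= [d1 d2] y; have e2 := ltW e20.
have D1 : (trunc (D0_dist x.1 y.1) <= trunc (D0_dist x'.1 y.1) + e / 2)%R.
  apply: trunc_lip; rewrite ?D0_dist_ge0// addeC.
  apply: le_trans (skorohod_dist_triangle _ x'.1 _ B0) _.
  by rewrite leeD2r// ltW.
have D2 : (trunc (D0_dist x'.1 y.1) <= trunc (D0_dist x.1 y.1) + e / 2)%R.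
  apply: trunc_lip; rewrite ?D0_dist_ge0// addeC.
  apply: le_trans (skorohod_dist_triangle _ x.1 _ B0) _.
  by rewrite leeD2r// skorohod_dist_sym// ltW.
have D3 : (trunc (S_dist x.2 y.2) <= trunc (S_dist x'.2 y.2) + e / 2)%R.
  apply: trunc_lip; rewrite ?S_dist_ge0// addeC.
  apply: le_trans (skorohod_dist_triangle _ (fun z => x'.2 (z 0 0))%R _ J0) _.
  by rewrite leeD2r// ltW.
have D4 : (trunc (S_dist x'.2 y.2) <= trunc (S_dist x.2 y.2) + e / 2)%R.
  apply: trunc_lip; rewrite ?S_dist_ge0// addeC.
  apply: le_trans (skorohod_dist_triangle _ (fun z => x.2 (z 0 0))%R _ J0) _.
  by rewrite leeD2r// skorohod_dist_sym// ltW.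
rewrite /pair_dist ler_norml; apply/andP; split; lra.
Qed.
End product_distance.

(** * The pieces of (J) *)

Section cells.
Context {R : realType}.
Implicit Types (a l : int -> R) (t : R).

Lemma series_from1_finite (u : nat -> R) (n : nat) :
  (forall k, (n <= k)%N -> (0 < k)%N -> u k = 0) ->
  series_from1 u = \sum_(1 <= k < n) u k.
Proof.
move=> u0; apply: cvg_lim => //; apply: cvg_near_cst.
exists n => // j /= nj.
have [n1|n1] := leqP 1 n; last first.
  rewrite [RHS]big_geq 1?ltnW// big1_seq// => i; rewrite mem_index_iota => /andP[_ /andP[i1 _]].
  by apply: u0 => //; rewrite (leq_trans _ i1)// ltnW.
rewrite (big_cat_nat n1 nj)/= [X in _ + X]big1_seq ?addr0// => i.
rewrite mem_index_iota => /andP[_ /andP[ni _]].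
by apply: u0 => //; exact: leq_trans ni.
Qed.

Lemma series_from1_0 (u : nat -> R) :
  (forall k, (0 < k)%N -> u k = 0) -> series_from1 u = 0.
Proof.
by move=> u0; rewrite (@series_from1_finite _ 0) ?big_geq// => k _; exact: u0.
Qed.

Lemma series_from1_single (u : nat -> R) (j : nat) : (0 < j)%N ->
  (forall k, (0 < k)%N -> k != j -> u k = 0) -> series_from1 u = u j.
Proof.
move=> j0 u0; rewrite (@series_from1_finite _ j.+1).
  rewrite big_nat_recr//= big1_seq ?add0r// => i.
  rewrite mem_index_iota => /andP[_ /andP[i1 ij]].
  by apply: u0 => //; rewrite ltn_eqF.
by move=> k jk k0; apply: u0 => //; rewrite gtn_eqF.
Qed.

Lemma series_from1_count (b : nat -> bool) (n : nat) :
  (forall k, (0 < k)%N -> b k = (k <= n)%N) -> series_from1 (fun k => (b k)%:R) = n%:R :> R.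
Proof.
move=> bn; rewrite (@series_from1_finite _ n.+1); last first.
  by move=> k nk k0; rewrite bn// leqNgt nk.
rewrite (eq_big_nat _ _ (F2 := fun=> 1)) ?sumr_const_nat ?subn1// => i /andP[i1 ij].
by rewrite bn// -ltnS ij.
Qed.

(** [l 0 < 0 < l 1] fixes the numbering: piece 0 has the origin in its interior. *)
Definition cells l :=
  [/\ {homo l : j k / j < k}, forall t, exists k, l k <= t < l (k + 1) &
      l 0 < 0 < l 1].

(* The placeholder [a 0] is removed: the [k]-th piece of (J) lives on
   [[cell_start a k, cell_start a (k + 1))]. *)
Definition cell_start a (k : int) : R := if 0 < k then a k else a (k - 1).

Lemma cell_startP a (n : nat) :
  (cell_start a n.+1 = a n.+1) /\ (cell_start a (- n%:Z) = a (- n.+1%:Z)).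
Proof.
split; first by rewrite /cell_start.
rewrite /cell_start ifN; [congr a; lia|lia].
Qed.

Lemma jump_sequence_cells a : jump_sequence a -> cells (cell_start a).
Proof.
move=> [a_mono a0 a_pinfty a_ninfty]; split.
- move=> j k jk; rewrite /cell_start; case: ifPn => j0; case: ifPn => k0; apply: a_mono => //.
  + by move: k0; rewrite (lt_trans j0 jk).
  + by rewrite (le_lt_trans _ k0)//; move: j0; rewrite -leNgt; lia.
  + by rewrite ltrD2r.
- move=> t.
  have [t0|t0] := leP 0 t.
    (* The least [n] with [t < a n] is positive because [a 0 = 0 <= t]; its predecessor numbers the
       piece. *)
    have ex : exists n : nat, t < a n%:Z.
      by have [n] := filter_ex (iffLR (cvgryPgt _) a_pinfty t); exists n.
    case: (ex_minnP ex) => -[|p] tp pmin; first by move: tp; rewrite a0 ltNge t0.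
    exists p%:Z; rewrite (_ : (p%:Z + 1 = p.+1%:Z)%R); last by lia.
    rewrite (cell_startP a p).1 tp andbT; case: p tp pmin => [|p] tp pmin.
      by rewrite /cell_start/= (le_trans _ t0)// -a0 ltW// a_mono.
    by rewrite (cell_startP a p).1 leNgt; apply/negP => /pmin; rewrite ltnn.
  (* For [t < 0], the least [n] with [a (- n) <= t] gives piece [1 - n], by the shift in
     [cell_start]. *)
  have ex : exists n : nat, a (- n%:Z) <= t.
    by have [n] := filter_ex (iffLR (cvgrNyPle _) a_ninfty t); exists n.
  case: (ex_minnP ex) => -[|p] tp pmin; first by move: tp; rewrite oppr0 a0 leNgt t0.
  exists (- p%:Z); rewrite (cell_startP a p).2 tp/=.
  case: p tp pmin => [|p] tp pmin.
    by rewrite oppr0 add0r /cell_start/= (lt_trans t0)// -a0 a_mono.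
  rewrite (_ : (- p.+1%:Z + 1 = - p%:Z)%R); last by lia.
  by rewrite (cell_startP a p).2 ltNge; apply/negP => /pmin; rewrite ltnn.
- by rewrite /cell_start/= -a0; apply/andP; split; apply: a_mono.
Qed.

Lemma cells_le l t i j : cells l -> l i <= t -> t < l (j + 1) -> i <= j.
Proof.
move=> [l_mono _ _] it tj; rewrite -ltzD1 ltNge; apply/negP.
rewrite le_eqVlt => /orP[/eqP e|/l_mono]; first by move: tj; rewrite e ltNge it.
by move=> /lt_le_trans/(_ it)/(lt_trans tj); rewrite ltxx.
Qed.

Lemma cells_inj l t j k : cells l -> l j <= t < l (j + 1) -> l k <= t < l (k + 1) ->
  j = k.
Proof.
move=> cl /andP[jt tj] /andP[kt tk]; apply/eqP; rewrite eq_le.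
by rewrite (cells_le cl jt tk) (cells_le cl kt tj).
Qed.

Lemma jump_sequence_le a t (j k : int) : jump_sequence a -> (j <= k) -> a j <= a k.
Proof.
move=> [a_mono _ _ _]; rewrite le_eqVlt => /orP[/eqP->//|/a_mono/ltW//].
Qed.

(** On piece [k > 0] exactly [a 1, ..., a k] have been passed, and on piece [k < 0] exactly
    [a (-1), ..., a k] lie ahead. The value thus determines the piece up to sign. *)
Lemma cells_counts (I : set R) (f : R -> R) a t k : jump_sequence a -> counts_jumps I f a ->
  I t -> cell_start a k <= t < cell_start a (k + 1) -> f t = `|k|%N%:R.
Proof.
move=> ja fa It; rewrite fa//.
have le := jump_sequence_le t ja.
case: k => [[|n]|n].
- rewrite add0r /cell_start/= sub0r => /andP[t1 t2].
  rewrite !series_from1_0 ?addr0// => i i0.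
    by rewrite ltNge (le_trans _ t1)//; apply: le; lia.
  by rewrite leNgt (lt_le_trans t2)//; apply: le; lia.
- rewrite (_ : (Posz n.+1 + 1 = n.+2%:Z)%R); last by lia.
  rewrite !(cell_startP a _).1 => /andP[t1 t2].
  rewrite (@series_from1_count _ n.+1) ?series_from1_0 ?addr0//.
    by move=> i i0; rewrite ltNge (le_trans _ t1)//; apply: le; lia.
  move=> i i0; have [ij|ij] := leqP i n.+1.
    by rewrite (le_trans _ t1)//; apply: le; lia.
  by rewrite leNgt (lt_le_trans t2)//; apply: le; lia.
- rewrite (_ : (Negz n + 1 = - n%:Z)%R); last by lia.
  rewrite NegzE !(cell_startP a _).2 => /andP[t1 t2].
  rewrite series_from1_0 ?add0r ?(@series_from1_count _ n.+1) ?abszN//.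
    move=> i i0; have [ij|ij] := leqP i n.+1.
      by rewrite (lt_le_trans t2)//; apply: le; lia.
    by rewrite ltNge (le_trans _ t1)//; apply: le; lia.
  by move=> i i0; rewrite leNgt (lt_le_trans t2)//; apply: le; lia.
Qed.

(** Exactly one indicator in (J) is nonzero at a given [t]; the sign of [k] tells in which of the
    three summands it occurs. *)
Lemma cells_form_J m (K : 'I_m.+1 -> set R) (psi : 'rV[R]_m.+1 -> R) a V x k :
  form_J K psi a V -> rect K x ->
  cell_start a k <= x 0 ord0 < cell_start a (k + 1) -> psi x = V k (tail_coords x).
Proof.
move=> [ja _ J] Kx; rewrite J//.
move: (x 0 ord0) (tail_coords x) => t xi.
have le := jump_sequence_le t ja.
case: k => [[|n]|n].
- rewrite add0r /cell_start/= sub0r => /andP[t1 t2].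
  rewrite t1 t2 mulr1 !series_from1_0 ?addr0// => i i0.
    by rewrite (_ : t < _ = false) ?andbF ?mulr0// ltNge (le_trans _ t1)//; apply: le; lia.
  by rewrite (_ : _ <= t = false) ?mulr0// leNgt (lt_le_trans t2)//; apply: le; lia.
- rewrite (_ : (Posz n.+1 + 1 = n.+2%:Z)%R); last by lia.
  rewrite !(cell_startP a _).1 => /andP[t1 t2].
  rewrite (_ : t < a 1 = false) ?andbF ?mulr0 ?add0r; last first.
    by rewrite ltNge (le_trans _ t1)//; apply: le; lia.
  rewrite [X in _ + X]series_from1_0 ?addr0; last first.
    move=> i i0.
    by rewrite (_ : t < _ = false) ?andbF ?mulr0// ltNge (le_trans _ t1)//; apply: le; lia.
  rewrite (@series_from1_single _ n.+1)//.
    by rewrite (_ : (n.+1%:Z + 1 = n.+2%:Z)%R) ?t1 ?t2 ?mulr1//; lia.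
  move=> i i0; rewrite neq_ltn => /orP[ij|ij].
    rewrite (_ : t < _ = false) ?andbF ?mulr0// ltNge (le_trans _ t1)//.
    by apply: le; lia.
  by rewrite (_ : _ <= t = false) ?mulr0// leNgt (lt_le_trans t2)//; apply: le; lia.
- rewrite (_ : (Negz n + 1 = - n%:Z)%R); last by lia.
  rewrite NegzE !(cell_startP a _).2 => /andP[t1 t2].
  rewrite (_ : a (-1) <= t = false) ?mulr0 ?add0r; last first.
    by rewrite leNgt (lt_le_trans t2)//; apply: le; lia.
  rewrite series_from1_0 ?add0r; last first.
    move=> i i0.
    by rewrite (_ : _ <= t = false) ?mulr0// leNgt (lt_le_trans t2)//; apply: le; lia.
  rewrite (@series_from1_single _ n.+1)//.
    by rewrite (_ : (- n.+1%:Z - 1 = - n.+2%:Z)%R) ?t1 ?t2 ?mulr1//; lia.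
  move=> i i0; rewrite neq_ltn => /orP[ij|ij].
    by rewrite (_ : _ <= t = false) ?mulr0// leNgt (lt_le_trans t2)//; apply: le; lia.
  rewrite (_ : t < _ = false) ?andbF ?mulr0// ltNge (le_trans _ t1)//.
  by apply: le; lia.
Qed.
End cells.

Section row_vectors.
Context {R : realType}.

Lemma rV_norm_leP n (x : 'rV[R]_n) (e : R) : 0 <= e ->
  `|x| <= e <-> forall k, `|x 0 k| <= e.
Proof.
move=> e0; have -> : `|x| = \big[Num.max/0]_ij `|x ij.1 ij.2| by exact: mx_normrE.
split.
  by move=> /bigmax_leP[_ xe] k; exact: (xe (0, k)).
by move=> xe; apply/bigmax_leP; split => // -[i k] _ /=; rewrite ord1.
Qed.

Lemma tail_coords_cvg m (s : nat -> 'rV[R]_m.+1) (x : 'rV[R]_m.+1) :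
  s n @[n --> \oo] --> x -> tail_coords (s n) @[n --> \oo] --> tail_coords x.
Proof.
move=> sx; apply/cvgrPdist_le => e e0; near=> n.
have /(rV_norm_leP _ (ltW e0)) xs : `|x - s n| <= e.
  by near: n; move/cvgrPdist_le : sx; exact.
by apply/(rV_norm_leP _ (ltW e0)) => k; have := xs (lift ord0 k); rewrite !mxE.
Unshelve. all: by end_near. Qed.

Lemma coord_cvg m (s : nat -> 'rV[R]_m) (x : 'rV[R]_m) k :
  s n @[n --> \oo] --> x -> s n 0 k @[n --> \oo] --> x 0 k.
Proof.
move=> sx; apply/cvgrPdist_le => e e0; near=> n.
have /(rV_norm_leP _ (ltW e0)) xs : `|x - s n| <= e.
  by near: n; move/cvgrPdist_le : sx; exact.
by have := xs k; rewrite !mxE.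
Unshelve. all: by end_near. Qed.

Lemma within_continuous_cvg (T : topologicalType) (U : topologicalType) (A : set T) (f : T -> U)
    (s : nat -> T) x :
  {within A, continuous f} -> A x -> (forall n, A (s n)) -> s n @[n --> \oo] --> x ->
  f (s n) @[n --> \oo] --> f x.
Proof.
move=> /subspace_continuousP fA Ax As sx W /(fA _ Ax) /sx [N _ hN].
by exists N => // n /hN /=; exact.
Qed.
End row_vectors.

(** * Maximizers in terms of the pieces *)

Section maximizers_by_cells.
Context {R : realType} {m : nat}.
Implicit Types (K : 'I_m.+1 -> set R) (psi : 'rV[R]_m.+1 -> R) (l : int -> R)
  (V : int -> 'rV[R]_m -> R).

Definition cell l k : set R := [set t | l k <= t < l (k + 1)].

(** The content of (J) once its series are evaluated piece by piece. *)
Definition cell_rep K psi l V :=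
  [/\ cells l, forall k, {within rect (tail_sides K), continuous (V k)} &
      forall x k, rect K x -> cell l k (x 0 ord0) -> psi x = V k (tail_coords x)].

Lemma form_J_cell_rep K psi a V : form_J K psi a V -> cell_rep K psi (cell_start a) V.
Proof.
move=> J; case: (J) => ja cV _; split => //; first exact: jump_sequence_cells.
by move=> x k Kx; exact: (cells_form_J J).
Qed.

Lemma tail_rect K x : rect K x -> rect (tail_sides K) (tail_coords x).
Proof. by move=> Kx k; rewrite mxE; exact: Kx. Qed.

Lemma cell_limit K psi l V (s : nat -> 'rV[R]_m.+1) x k :
  cell_rep K psi l V -> rect K x -> (forall n, rect K (s n)) ->
  s n @[n --> \oo] --> x -> (\forall n \near \oo, cell l k (s n 0 ord0)) ->
  closure (K ord0 `&` cell l k) (x 0 ord0) /\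
  psi (s n) @[n --> \oo] --> V k (tail_coords x).
Proof.
move=> [_ cV psiV] Kx Ks sx sk; split.
  move=> W xW; have sW : \forall n \near \oo, W (s n 0 ord0) := coord_cvg sx xW.
  have [n [Wn sn]] := filter_ex (filterI sW sk).
  by exists (s n 0 ord0); split => //; split => //; exact: Ks.
have Vs : V k (tail_coords (s n)) @[n --> \oo] --> V k (tail_coords x).
  apply: (within_continuous_cvg (cV k)); first exact: tail_rect.
    by move=> n; exact: tail_rect.
  exact: tail_coords_cvg.
apply: cvg_trans Vs; apply: near_eq_cvg; near=> n.
rewrite (psiV _ k) //; near: n; exact: sk.
Unshelve. all: by end_near. Qed.

(** Without such a sequence the limit in [quadrant_limit] would hold vacuously for every [l]. The
    sides being intervals, the segment from [x] to a point of the quadrant provides one. *)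
Lemma quadrant_approach K rho x : closed_rectangle K -> rect K x ->
  quadrant K rho x !=set0 -> exists s : nat -> 'rV[R]_m.+1,
  (forall n, quadrant K rho x (s n)) /\ s n @[n --> \oo] --> x.
Proof.
move=> clK Kx [y [Ky yx]].
pose s (n : nat) : 'rV[R]_m.+1 := x + n.+1%:R^-1 *: (y - x).
exists s; split.
  move=> n; have n0 : (0 : R) < n.+1%:R^-1 by rewrite invr_gt0.
  have n1 : (n.+1%:R^-1 : R) <= 1 by rewrite invf_le1// ler1n.
  split=> k; rewrite !mxE; have := yx k; case: (rho k) => xyk.
  - have [+ _ _] := clK k; move=> /(_ _ _ (Kx k) (Ky k)); apply.
    apply/andP; split; first by rewrite lerDl mulr_ge0 ?subr_ge0// ltW.
    by rewrite -lerBrDl ler_piMl ?subr_ge0// ltW.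
  - have [+ _ _] := clK k; move=> /(_ _ _ (Ky k) (Kx k)); apply.
    apply/andP; split; last by rewrite gerDl mulr_ge0_le0 ?subr_le0// ltW.
    by rewrite -lerBlDl ler_niMl ?subr_le0// ltW.
  - by rewrite ltrDl mulr_gt0// subr_gt0.
  - by rewrite gtrDl pmulr_rlt0// subr_lt0.
rewrite -[X in _ --> X](addr0 x) -[X in _ + X](scale0r (y - x)).
apply: cvgD; first exact: cvg_cst.
by apply: cvgZr_tmp; exact: cvg_harmonic.
Qed.

(** Inside a piece [psi] is [V k], and a sequence in a quadrant eventually stays in one piece, so
    every quadrant limit is also a value of some [V k]. Conversely, such a value over the closure of
    a piece is either a value of [psi] or a limit from the left. *)
Lemma maximizer_cellP K psi l V x : closed_rectangle K -> cell_rep K psi l V ->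
  is_maximizer K psi x <->
  rect K x /\ exists k, closure (K ord0 `&` cell l k) (x 0 ord0) /\
    (V k (tail_coords x))%:E = sup_on (rect K) psi.
Proof.
move=> clK rep; have [[l_mono l_ex _] cV psiV] := rep.
split.
  move=> [Kx [psix|[rho [r [[qne qlim] rsup]]]]]; split => //.
    have [k kx] := l_ex (x 0 ord0); exists k; split.
      by apply: subset_closure; split => //; exact: Kx.
    by rewrite -psiV.
  have [s [qs sx]] := quadrant_approach clK Kx qne.
  have s0x := coord_cvg (k := ord0) sx.
  have [k sk] : exists k, \forall n \near \oo, cell l k (s n 0 ord0).
    (* With sign [+] the sequence ends up in the piece of [x 0 ord0]. With sign [-] it comes from
       the left, so if [x 0 ord0] starts a piece it ends up in the preceding one. *)
    case rho0 : (rho ord0).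
      have [k /andP[kx xk]] := l_ex (x 0 ord0); exists k.
      near=> n; apply/andP; split.
        have [_ /(_ ord0)] := qs n; rewrite rho0 => /ltW; exact: le_trans.
      by near: n; exact: (cvgr_lt _ s0x).
    have [k [kx xk]] : exists k, l k < x 0 ord0 /\ x 0 ord0 <= l (k + 1).
      have [k /andP[kx xk]] := l_ex (x 0 ord0).
      move: kx; rewrite le_eqVlt => /orP[/eqP kx|kx]; last by exists k; rewrite ltW.
      by exists (k - 1); rewrite subrK -kx lexx; split => //; apply: l_mono; lia.
    exists k; near=> n; apply/andP; split.
      by near: n; exact: (cvgr_ge _ s0x).
    by have [_ /(_ ord0)] := qs n; rewrite rho0 => /lt_le_trans; apply.
  have [cx Vx] := cell_limit rep Kx (fun n => proj1 (qs n)) sx sk.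
  exists k; split => //; rewrite -rsup; congr EFin.
  by apply: (cvg_unique _ Vx (qlim _ qs sx)).
move=> [Kx [k [cx Vsup]]]; split => //.
have [xl xr] : l k <= x 0 ord0 /\ x 0 ord0 <= l (k + 1).
  split.
    change ([set t | l k <= t] (x 0 ord0)); rewrite (iffLR (closure_id _) (@closed_ge R (l k))).
    by move: cx; apply: closure_subset => t [_ /andP[]].
  change ([set t | t <= l (k + 1)] (x 0 ord0)).
  rewrite (iffLR (closure_id _) (@closed_le R (l (k + 1)))).
  by move: cx; apply: closure_subset => t [_ /andP[_ /ltW]].
(* Pieces contain their left ends; only at the right end is a one-sided limit called for. *)
move: xr; rewrite le_eqVlt => /orP[/eqP xr|xr]; last first.
  by left; rewrite (psiV _ k)//; apply/andP.
right.
have [t0 [Kt0 /andP[_ t0k]]] : K ord0 `&` cell l k !=set0.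
  by have [t [? _]] := cx _ filterT; exists t.
(* The first sign is [-], to approach from within the piece. The other signs are free and are chosen
   to point into [K], whose sides are nondegenerate. *)
have /choice[q qP] : forall j, exists p : bool * R, [/\ K j p.2,
    if p.1 then x 0 j < p.2 else p.2 < x 0 j & j = ord0 -> p.1 = false].
  move=> j; have [->|j0] := eqVneq j ord0.
    by exists (false, t0); split => //=; rewrite xr.
  have [_ _ [u [v [Ku Kv uv]]]] := clK j.
  have [vx|xv] := leP v (x 0 j).
    by exists (false, u); split => //=; rewrite (lt_le_trans uv).
  by exists (true, v); split => // /eqP; rewrite (negbTE j0).
exists (fun j => (q j).1), (V k (tail_coords x)); split => //; split.
  by exists (\row_j (q j).2); split => j; rewrite mxE; have [] := qP j.
move=> s qs sx.
have sk : \forall n \near \oo, cell l k (s n 0 ord0).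
  near=> n; apply/andP; split.
    near: n; apply: (cvgr_ge _ (coord_cvg (k := ord0) sx)).
    by rewrite xr; apply: l_mono; lia.
  have [_ /(_ ord0)] := qs n; have [_ _ ->//] := qP ord0; by rewrite xr.
by have [] := cell_limit rep Kx (fun n => proj1 (qs n)) sx sk.
Unshelve. all: by end_near. Qed.

End maximizers_by_cells.

(** * Continuity of the argmaxes *)

Section cons_coord.
Context {R : realType} {m : nat}.

Definition cons_coord (t : R) (xi : 'rV[R]_m) : 'rV[R]_m.+1 :=
  \row_j (if unlift ord0 j is Some k then xi 0 k else t).

Lemma cons_coord0 t xi : cons_coord t xi 0 ord0 = t.
Proof. by rewrite mxE unlift_none. Qed.

Lemma tail_cons_coord t xi : tail_coords (cons_coord t xi) = xi.
Proof. by apply/rowP => k; rewrite !mxE liftK. Qed.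

Lemma rect_cons_coord (K : 'I_m.+1 -> set R) t xi :
  K ord0 t -> rect (tail_sides K) xi -> rect K (cons_coord t xi).
Proof.
move=> Kt Kxi j; rewrite mxE; case: (unliftP ord0 j) => [k ->|->//].
exact: Kxi.
Qed.

Lemma norm_head_tail (x y : 'rV[R]_m.+1) (e : R) : 0 <= e ->
  `|x 0 ord0 - y 0 ord0| <= e -> `|tail_coords x - tail_coords y| <= e -> `|x - y| <= e.
Proof.
move=> e0 h /(rV_norm_leP _ e0) ht; apply/(rV_norm_leP _ e0) => j.
case: (unliftP ord0 j) => [k ->|->]; last by rewrite !mxE.
by have := ht k; rewrite !mxE.
Qed.
End cons_coord.

(** * Constants uniform over finitely many pieces *)

Section finite_ranges.
Context {R : realType}.

Lemma uniform_range (Q : int -> R -> Prop) (j k : int) :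
  (forall i e e', 0 < e' -> e' <= e -> Q i e -> Q i e') ->
  (forall i, exists2 e, 0 < e & Q i e) ->
  exists2 e, 0 < e & forall i, j <= i <= k -> Q i e.
Proof.
move=> Qmono Qex.
have [n kn] : exists n : nat, k < j + n%:Z by exists `|k - j|.+1%N; lia.
suff [e e0 Qe] : exists2 e, 0 < e & forall i, j <= i < j + n%:Z -> Q i e.
  by exists e => // i /andP[ji ik]; apply: Qe; rewrite ji (le_lt_trans ik).
elim: n {k kn} => [|n [e e0 Qe]]; first by exists 1 => // i; lia.
have [e' e'0 Qe'] := Qex (j + n%:Z).
exists (Num.min e e'); first by rewrite lt_min e0.
have ee0 : 0 < Num.min e e' by rewrite lt_min e0.
move=> i ji; have [->|ijn] := eqVneq i (j + n%:Z).
  by apply: Qmono Qe' => //; rewrite ge_min lexx orbT.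
by apply: (Qmono _ e) => //; [rewrite ge_min lexx|apply: Qe; lia].
Qed.

Lemma cells_range (l : int -> R) (u v : R) : cells l ->
  exists j k, forall i t, u <= t <= v -> cell l i t -> j <= i <= k.
Proof.
move=> cl; have [_ l_ex _] := cl.
have [j /andP[ju uj]] := l_ex u; have [k /andP[kv vk]] := l_ex v.
exists j, k => i t /andP[ut tv] /andP[it ti]; apply/andP; split.
  exact: (cells_le cl (le_trans ju ut) ti).
exact: (cells_le cl it (le_lt_trans tv vk)).
Qed.

(** On the compact set of points at distance at least [e] from [xi0], [f] attains its maximum, which
    is therefore below [s]; [eta] is the gap. *)
Lemma compact_strict_max m (A : set 'rV[R]_m) (f : 'rV[R]_m -> R) (xi0 : 'rV[R]_m) (s e : R) :
  compact A -> {within A, continuous f} -> 0 < e ->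
  (forall xi, A xi -> f xi <= s) -> (forall xi, A xi -> f xi = s -> xi = xi0) ->
  exists2 eta, 0 < eta & forall xi, A xi -> s - eta < f xi -> `|xi - xi0| <= e.
Proof.
move=> cA cf e0 fs fs0.
pose A' := A `&` [set xi | e <= `|xi - xi0|].
have cA' : compact A'.
  apply: compact_closedI => //.
  have cn : continuous (fun xi : 'rV[R]_m => `|xi - xi0|).
    move=> xi; apply/(@cvgrPdist_le _ _ _ (nbhs xi) (nbhs_filter xi)) => e' e'0.
    near=> y.
    apply: le_trans (ler_dist_dist _ _) _; rewrite opprB addrA subrK.
    by near: y; apply: (@cvgr_dist_le _ _ _ (nbhs xi) (nbhs_filter xi) id xi).
  exact: (preimage_closed (fun xi _ => cn xi) (@closed_ge R e)).
have [[c0 A'c0]|A'0] := pselect (A' !=set0).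
  have [c] : exists2 c, c \in A' & forall t, t \in A' -> f t <= f c.
    apply: EVT_max_rV => //; first by exists c0.
    by apply: continuous_subspaceW cf => xi [].
  rewrite inE => -[Ac ec] cmax.
  have fcs : f c < s.
    rewrite lt_neqAle fs// andbT; apply/eqP => /(fs0 _ Ac) cxi.
    by move: ec; rewrite /= cxi subrr normr0 leNgt e0.
  exists (s - f c); first by rewrite subr_gt0.
  move=> xi Axi; rewrite opprB addrCA subrr addr0 => fcxi.
  rewrite leNgt; apply/negP => exi.
  have /cmax : xi \in A' by rewrite inE; split => //; exact: ltW.
  by rewrite leNgt fcxi.
exists 1 => // xi Axi _; rewrite leNgt; apply/negP => exi; apply: A'0.
by exists xi; split => //; exact: ltW.
Unshelve. all: by end_near. Qed.

(* Every piece that meets [[u, v]] has a test point that stays in the piece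
   under small perturbations fixing the endpoint [v], which matters when the
   piece meets [[u, v]] in [v] only. *)
Lemma cell_margin (l : int -> R) (u v : R) j : u < v ->
  exists2 eta, 0 < eta &
    (exists t, u <= t <= v /\ cell l j t) ->
    exists t, [/\ u <= t <= v, cell l j t & forall t', u <= t' <= v ->
      `|t' - t| <= eta -> (t = v -> t' = v) -> cell l j t'].
Proof.
move=> uv; pose a := Num.max (l j) u; pose b := Num.min (l (j + 1)) v.
have [ab|ba] := ltP a b.
  exists ((b - a) / 4); first by rewrite divr_gt0// subr_gt0.
  move=> _; exists ((a + b) / 2).
  have [la ua] : l j <= a /\ u <= a by rewrite /a !le_max !lexx orbT.
  have [bl bv] : b <= l (j + 1) /\ b <= v by rewrite /b !ge_min !lexx orbT.
  split; [by apply/andP; split; lra|by apply/andP; split; lra|].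
  by move=> t' _; rewrite ler_norml => /andP[h1 h2] _; apply/andP; split; lra.
exists 1 => // -[t [/andP[ut tv] /andP[jt tj]]].
have tE : t = v.
  have : b <= t by apply: le_trans ba _; rewrite /a ge_max jt ut.
  rewrite /b ge_min leNgt tj/= => vt.
  by apply/eqP; rewrite eq_le tv vt.
exists t; split => //; [by rewrite ut tv|by apply/andP|].
by move=> t' _ _ /(_ tE) ->; rewrite -tE; apply/andP.
Qed.
End finite_ranges.

(** * Deviation of a time change from the identity *)

Section time_change_deviation.
Context {R : realType}.

Lemma time_change_left (I : set R) (la : R -> R) u : time_change I la -> I u ->
  (forall t, I t -> u <= t) -> la u = u.
Proof.
move=> tl Iu uI; have [s Is las] := time_change_surj tl Iu.
have := uI _ Is; rewrite le_eqVlt => /orP[/eqP us|us]; first by rewrite {1}us.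
have := time_change_lt tl Iu Is us; rewrite las ltNge.
by rewrite uI//; exact: (time_change_in tl).
Qed.

Lemma time_change_right (I : set R) (la : R -> R) v : time_change I la -> I v ->
  (forall t, I t -> t <= v) -> la v = v.
Proof.
move=> tl Iv vI; have [s Is las] := time_change_surj tl Iv.
have := vI _ Is; rewrite le_eqVlt => /orP[/eqP sv|sv]; first by rewrite -{1}sv.
have := time_change_lt tl Is Iv sv; rewrite las ltNge.
by rewrite vI//; exact: (time_change_in tl).
Qed.

(** The left end [u] is fixed, so [la t - t] is [t - u] times the slope from [u] minus one, and this
    slope lies between [expR (- a)] and [expR a]. *)
Lemma time_change_dist (I : set R) (la : R -> R) (a r : R) u t : time_change I la ->
  I u -> (forall t, I t -> u <= t <= u + r) -> 0 <= a ->
  (log_slope I la <= a%:E)%E -> I t -> `|la t - t| <= r * (expR a - 1).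
Proof.
move=> tl Iu uI a0 /log_slope_leP la_a It.
have lu : la u = u by apply: time_change_left tl Iu _ => s /uI /andP[].
have /andP[ut tr] := uI _ It.
have r0 : 0 <= r by lra.
have ea : a <= expR a - 1 by rewrite lerBrDl expR_ge1Dx.
move: (ut); rewrite le_eqVlt => /orP[/eqP <-|ult].
  by rewrite lu subrr normr0 mulr_ge0//; lra.
have q0 : 0 < (la t - la u) / (t - u) by apply: (time_change_slope_gt0 tl) => //; rewrite lt_eqF.
have := la_a _ _ Iu It; rewrite lt_eqF// => /(_ isT).
rewrite ler_norml lu in q0 * => /andP[h1 h2].
have tu0 : 0 < t - u by rewrite subr_gt0.
have q1 : (la t - u) / (t - u) <= expR a by rewrite -[leLHS]lnK// ler_expR.
(* With [a <= expR a - 1], this makes the lower bound symmetric to the upper one. *)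
have q2 : 1 - a <= (la t - u) / (t - u).
  rewrite -[leRHS]lnK//; apply: le_trans (expR_ge1Dx (- a)) _.
  by rewrite ler_expR.
rewrite ler_pdivrMr// in q1; rewrite ler_pdivlMr// in q2.
apply: (@le_trans _ _ ((t - u) * (expR a - 1))); last first.
  by apply: ler_wpM2r; lra.
rewrite ler_norml; apply/andP; split.
  have : (t - u) * a <= (t - u) * (expR a - 1) by rewrite ler_pM2l.
  by move: q2; rewrite mulrBl mul1r [a * _]mulrC; lra.
by move: q1; rewrite [(t - u) * (_ - _)]mulrBr mulr1 [expR a * _]mulrC; lra.
Qed.

Lemma small_dist (r kap : R) : 0 <= r -> 0 < kap ->
  exists2 del, 0 < del & forall a, a <= del -> r * (expR a - 1) <= kap.
Proof.
(* [r + 1] in place of [r], which may be 0. *)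
move=> r0 kap0; have q0 : 0 < kap / (r + 1) by rewrite divr_gt0// ltr_wpDl.
exists (ln (1 + kap / (r + 1))); first by rewrite ln_gt0// ltrDl.
move=> a ad.
have : expR a <= 1 + kap / (r + 1).
  by rewrite -[leRHS]lnK ?ler_expR// posrE ltr_wpDr ?ltr01 ?ltW.
rewrite -lerBlDl => /(ler_wpM2l r0)/le_trans; apply.
by rewrite mulrCA ger_pMr// ler_pdivrMr ?mul1r ?lerDl// ltr_wpDl.
Qed.
End time_change_deviation.

(** * The winning piece of the limit *)

Section limit_maximizers.
Context {R : realType} {m : nat}.
Variables (K : 'I_m.+1 -> set R) (psi : 'rV[R]_m.+1 -> R) (l : int -> R)
  (V : int -> 'rV[R]_m -> R).
Hypothesis clK : closed_rectangle K.
Hypothesis rep : cell_rep K psi l V.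
Let K2 := rect (tail_sides K).

Lemma cell_le_sup j t xi : K ord0 t -> cell l j t -> K2 xi ->
  ((V j xi)%:E <= sup_on (rect K) psi)%E.
Proof.
move=> Kt jt K2xi; have [_ _ psiV] := rep.
apply: ereal_sup_ubound; exists (cons_coord t xi); first exact: rect_cons_coord.
by rewrite (psiV _ j) ?tail_cons_coord ?cons_coord0//; exact: rect_cons_coord.
Qed.

Lemma closure_nonempty (A : set R) t : closure A t -> A !=set0.
Proof. by move=> At; have [p [Ap _]] := At _ filterT; exists p. Qed.

Hypothesis V_max : forall j, exists! xi,
  K2 xi /\ forall eta, K2 eta -> V j eta <= V j xi.
Hypothesis V_distinct : forall A : set int, finite_set A -> A !=set0 ->
  exists! j, A j /\ ereal_sup [set sup_on K2 (V i) | i in A] = sup_on K2 (V j).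

Lemma sup_on_max (A : set 'rV[R]_m) (f : 'rV[R]_m -> R) xi :
  A xi -> (forall eta, A eta -> f eta <= f xi) -> sup_on A f = (f xi)%:E.
Proof.
move=> Axi fxi; apply/eqP; rewrite eq_le; apply/andP; split.
  by apply: ge_ereal_sup => _ [eta Aeta <-]; rewrite lee_fin fxi.
by apply: ereal_sup_ubound; exists xi.
Qed.

(** Every piece that meets [K_1] has [V j <= s], and two of them cannot both reach [s], their maxima
    being distinct. All maximizers therefore share the piece [k] and the unique maximizer of
    [V k]. *)
Lemma unique_winner x : is_maximizer K psi x -> exists k s,
  [/\ s%:E = sup_on (rect K) psi,
      V k (tail_coords x) = s,
      forall y, is_maximizer K psi y ->
        closure (K ord0 `&` cell l k) (y 0 ord0) /\ tail_coords y = tail_coords x,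
      forall xi, K2 xi -> V k xi <= s /\ (V k xi = s -> xi = tail_coords x) &
      forall j, K ord0 `&` cell l j !=set0 -> j <> k ->
        exists2 eta, 0 < eta & forall xi, K2 xi -> V j xi <= s - eta].
Proof.
move=> /(maximizer_cellP _ clK rep)[Kx [k [cx Vx]]].
have K2x : K2 (tail_coords x) by exact: tail_rect.
pose s := V k (tail_coords x).
have active_le j xi : K ord0 `&` cell l j !=set0 -> K2 xi -> V j xi <= s.
  by move=> [t [Kt jt]] K2xi; rewrite -lee_fin Vx; exact: cell_le_sup jt K2xi.
have kmax xi : K2 xi -> V k xi <= s by apply: active_le; exact: closure_nonempty cx.
have kuniq xi : K2 xi -> V k xi = s -> xi = tail_coords x.
  move=> K2xi Vxi; have [xi' [_ u]] := V_max k.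
  rewrite -(u xi); first exact: u.
  by split => // eta /kmax; rewrite Vxi.
have gap j : K ord0 `&` cell l j !=set0 -> j <> k ->
    exists2 eta, 0 < eta & forall xi, K2 xi -> V j xi <= s - eta.
  move=> jact jk; have [xij [[K2xij xijmax] _]] := V_max j.
  have Vjs : V j xij < s.
    rewrite lt_neqAle active_le// andbT; apply/eqP => Vjs.
    (* The two-element set [[set j; k]] would have two winners. *)
    have [||i [_ iu]] := V_distinct (A := [set j; k]); first exact: finite_set2.
      by exists j; left.
    have supj : sup_on K2 (V j) = s%:E by rewrite (sup_on_max K2xij xijmax) Vjs.
    have supk : sup_on K2 (V k) = s%:E by rewrite (sup_on_max K2x kmax).
    have supA : ereal_sup [set sup_on K2 (V i) | i in [set j; k]] = s%:E.
      apply/eqP; rewrite eq_le; apply/andP; split.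
        by apply: ge_ereal_sup => _ [_ [->|->] <-]; rewrite ?supj ?supk.
      by apply: ereal_sup_ubound; exists k => //; right.
    apply: jk; rewrite -(iu j); last by split; [left|rewrite supA supj].
    by apply: iu; split; [right|rewrite supA supk].
  exists (s - V j xij); first by rewrite subr_gt0.
  by move=> xi K2xi; rewrite opprB addrCA subrr addr0 xijmax.
exists k, s; split => //; last by move=> xi K2xi; split; [exact: kmax|exact: kuniq].
move=> y /(maximizer_cellP _ clK rep)[Ky [k' [cy Vy]]].
have k'k : k' = k.
  apply: contrapT => /(gap _ (closure_nonempty cy))[eta eta0].
  move=> /(_ _ (tail_rect Ky)); rewrite -lee_fin Vy -Vx lee_fin.
  by rewrite -/s lerBrDr gerDl leNgt eta0.
by subst k'; split => //; apply: kuniq; [exact: tail_rect|apply: EFin_inj; rewrite Vy].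
Qed.

(** Only finitely many pieces meet [[u, v]]. For the winning one the bound is [compact_strict_max],
    for the others it is the gap of their maxima to [s]. *)
Lemma winner_gap (B : 'I_m.+1 -> set R) (u v : R) k s xi0 (e : R) :
  subrectangle B K -> (forall j, compact (B j)) -> (forall t, B ord0 t -> u <= t <= v) ->
  (forall xi, K2 xi -> V k xi <= s /\ (V k xi = s -> xi = xi0)) ->
  (forall j, K ord0 `&` cell l j !=set0 -> j <> k ->
    exists2 eta, 0 < eta & forall xi, K2 xi -> V j xi <= s - eta) ->
  0 < e ->
  exists2 eta, 0 < eta & forall z, rect B z -> s - eta < psi z ->
    cell l k (z 0 ord0) /\ `|tail_coords z - xi0| <= e.
Proof.
move=> BK cB Buv kuniq gap e0; have [cl cV psiV] := rep.
have [j1 [j2 jr]] := cells_range u v cl.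
pose Q j eta := forall z, rect B z -> cell l j (z 0 ord0) -> s - eta < psi z ->
    cell l k (z 0 ord0) /\ `|tail_coords z - xi0| <= e.
have BK2 xi : rect (tail_sides B) xi -> K2 xi by move=> Bxi i; apply/BK/Bxi.
have [eta eta0 Qeta] : exists2 eta, 0 < eta & forall j, j1 <= j <= j2 -> Q j eta.
  apply: uniform_range.
    move=> j e1 e2 _ e21 Qj z Bz jz sz; apply: (Qj z) => //.
    by apply: le_lt_trans sz; rewrite lerD2l lerN2.
  move=> j; have [->|/eqP jk] := eqVneq j k.
    have cBt : compact (rect (tail_sides B)).
      by apply: rV_compact => i; exact: cB.
    have cVB : {within rect (tail_sides B), continuous (V k)}.
      exact: continuous_subspaceW (cV k).
    have [||eta eta0 he] := compact_strict_max (s := s) (xi0 := xi0) cBt cVB e0.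
    - by move=> xi /BK2 /kuniq[].
    - by move=> xi /BK2 /kuniq[].
    exists eta => // z Bz kz sz; split => //; apply: he; first exact: tail_rect.
    by rewrite -(psiV _ k)// => i; apply/BK/Bz.
  have [jact|jact] := pselect (K ord0 `&` cell l j !=set0); last first.
    exists 1 => // z Bz jz; exfalso; apply: jact; exists (z 0 ord0).
    by split => //; apply/BK/Bz.
  have [eta eta0 he] := gap _ jact jk.
  exists eta => // z Bz jz; rewrite (psiV _ j)//; last by move=> i; apply/BK/Bz.
  by rewrite ltNge he//; apply: BK2; exact: tail_rect.
exists eta => // z Bz; have [_ l_ex _] := cl; have [j jz] := l_ex (z 0 ord0).
by apply: (Qeta j) => //; apply: jr jz; exact/Buv/Bz.
Qed.
End limit_maximizers.

(** * Matching the pieces of two functions *)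

Section matching.
Context {R : realType}.

Lemma absz_sign_inj (k k' : int) :
  `|k|%N = `|k'|%N -> (0 < k -> 0 <= k') -> (k < 0 -> k' <= 0) -> k = k'.
Proof. lia. Qed.

(** [f t] and [f' t'] are integers less than 1 apart, so the two indices agree up to sign. The sign
    agrees because [kap] is too small for [t'] to be on the other side of the origin when [t] lies
    outside piece 0 of [l]. *)
Lemma cells_match (I : set R) (l l' : int -> R) (f f' : R -> R) (t t' kap : R) k :
  cells l -> cells l' ->
  (forall s j, I s -> cell l j s -> f s = `|j|%N%:R) ->
  (forall s j, I s -> cell l' j s -> f' s = `|j|%N%:R) ->
  I t -> I t' -> `|f t - f' t'| < 1 -> `|t' - t| <= kap -> kap < l 1 -> kap < - l 0 ->
  cell l k t -> cell l' k t'.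
Proof.
move=> cl cl' fl fl' It It' ff tt' k1 k0 kt.
have [l_mono _ /andP[l0 l1]] := cl; have [l'_mono l'_ex /andP[l'0 l'1]] := cl'.
have le j i : j <= i -> l j <= l i.
  by rewrite le_eqVlt => /orP[/eqP->//|/l_mono/ltW].
have le' j i : j <= i -> l' j <= l' i.
  by rewrite le_eqVlt => /orP[/eqP->//|/l'_mono/ltW].
have [k' k't'] := l'_ex t'.
suff -> : k = k' by [].
move: tt'; rewrite ler_norml => /andP[t1 t2].
move: (kt) (k't') => /andP[kt1 tk] /andP[k't1 t'k'].
apply: absz_sign_inj => [|kpos|kneg].
- move: ff; rewrite (fl _ _ It kt) (fl' _ _ It' k't').
  have -> : (`|k|%N%:R - `|k'|%N%:R : R) = (`|k|%N%:Z - `|k'|%N%:Z)%:~R by rewrite rmorphB.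
  rewrite -intr_norm -[1]/(1%:~R) ltr_int; clear; lia.
- have tl1 : l 1 <= t by apply: le_trans (le _ _ _) kt1; rewrite -gtz0_ge1.
  rewrite leNgt; apply/negP => k'0.
  have : l' (k' + 1) <= l' 0 by apply: le'; rewrite lezD1.
  by move=> ?; lra.
- have tl0 : t < l 0 by apply: lt_le_trans tk (le _ _ _); rewrite lezD1.
  rewrite leNgt; apply/negP => k'0.
  have : l' 1 <= l' k' by apply: le'; rewrite -gtz0_ge1.
  by move=> ?; lra.
Qed.

(** [x] and [x'] are the infima of [S] and [S'], and points of either set are approximated within
    [kap] by points of the other. *)
Lemma lower_ends_close (S S' : set R) (x x' kap : R) : closure S x -> closure S' x' ->
  (forall t, S t -> x <= t) -> (forall t, S' t -> x' <= t) ->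
  (forall t, S t -> exists2 t', S' t' & `|t' - t| <= kap) ->
  (forall t', S' t' -> exists2 t, S t & `|t' - t| <= kap) ->
  `|x' - x| <= kap.
Proof.
move=> cx cx' lx lx' SS' S'S; apply/ler_addgt0Pr => e e0.
have [t [St /ltW]] := cx _ (nbhsx_ballx x e e0).
have [t' [S't' /ltW]] := cx' _ (nbhsx_ballx x' e e0).
have [t1 S't1] := SS' _ St; have [t2 St2] := S'S _ S't'.
have := lx _ St2; have := lx' _ S't1.
rewrite !ler_norml => ? ? /andP[? ?] /andP[? ?] /andP[? ?] /andP[? ?].
by apply/andP; split; lra.
Qed.

Lemma upper_ends_close (S S' : set R) (x x' kap : R) : closure S x -> closure S' x' ->
  (forall t, S t -> t <= x) -> (forall t, S' t -> t <= x') ->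
  (forall t, S t -> exists2 t', S' t' & `|t' - t| <= kap) ->
  (forall t', S' t' -> exists2 t, S t & `|t' - t| <= kap) ->
  `|x' - x| <= kap.
Proof.
move=> cx cx' lx lx' SS' S'S; apply/ler_addgt0Pr => e e0.
have [t [St /ltW]] := cx _ (nbhsx_ballx x e e0).
have [t' [S't' /ltW]] := cx' _ (nbhsx_ballx x' e e0).
have [t1 S't1] := SS' _ St; have [t2 St2] := S'S _ S't'.
have := lx _ St2; have := lx' _ S't1.
rewrite !ler_norml => ? ? /andP[? ?] /andP[? ?] /andP[? ?] /andP[? ?].
by apply/andP; split; lra.
Qed.
End matching.

(** * Argmaxes of nearby functions *)

Section argmax_continuity.
Context {R : realType} {m : nat}.

Lemma compact_intervalE (I : set R) : closed_interval I -> compact I ->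
  exists u v, u < v /\ forall t, I t <-> u <= t <= v.
Proof.
move=> [itvI _ [p [q [Ip Iq pq]]]] cI.
have I0 : I !=set0 by exists p.
have cid : {within I, continuous (@idfun R)}.
  by apply: continuous_subspaceT => x; exact: cvg_id.
have [u Iu umin] := compact_EVT_min I0 cI cid.
have [v Iv vmax] := compact_EVT_max I0 cI cid.
rewrite !inE in Iu Iv.
have umin' t : I t -> u <= t by move=> It; apply: umin; rewrite inE.
have vmax' t : I t -> t <= v by move=> It; apply: vmax; rewrite inE.
exists u, v; split; first by rewrite (le_lt_trans (umin' _ Ip))// (lt_le_trans pq)// vmax'.
move=> t; split => [It|/(itvI _ _ Iu Iv)//].
by rewrite umin' ?vmax'.
Qed.

Lemma closure_truncate (A : set R) (r x : R) : `|x| < r -> closure A x ->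
  closure (A `&` [set t | `|t| <= r]) x.
Proof.
move=> xr Ax W xW; have h : 0 < r - `|x| by rewrite subr_gt0.
have [t [At [Wt xt]]] := Ax _ (filterI xW (nbhsx_ballx x _ h)).
exists t; split => //; split => //=.
by rewrite -(subrK x t) (le_trans (ler_normD _ _))// -lerBrDr distrC ltW.
Qed.

Variables (K : 'I_m.+1 -> set R) (psi : 'rV[R]_m.+1 -> R) (gam : R -> R)
  (l : int -> R) (V : int -> 'rV[R]_m -> R).
Hypothesis clK : closed_rectangle K.
Hypothesis rep : cell_rep K psi l V.
Hypothesis gamE : forall t k, K ord0 t -> cell l k t -> gam t = `|k|%N%:R.
Let K2 := rect (tail_sides K).
Hypothesis V_max : forall j, exists! xi,
  K2 xi /\ forall eta, K2 eta -> V j eta <= V j xi.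
Hypothesis V_distinct : forall A : set int, finite_set A -> A !=set0 ->
  exists! j, A j /\ ereal_sup [set sup_on K2 (V i) | i in A] = sup_on K2 (V j).

(** The distances control [psi'] on [B] only, so its argmaxes over [K] are required to have norm
    below [r], which puts them in [B]. Two unrelated time changes are at work: [nu] matches the
    pieces, through [gam], and [la] compares the values of [psi] and [psi']. *)
Lemma argmaxes_continuous (B : 'I_m.+1 -> set R) (r e : R) x0 y0 :
  (forall k, B k = K k `&` [set t | `|t| <= r]) -> compact_rectangle B ->
  is_sargmax K psi x0 -> is_largmax K psi y0 -> `|x0| < r -> `|y0| < r -> 0 < e ->
  exists2 del, 0 < del & forall psi' gam' l' V' x y,
    cell_rep K psi' l' V' ->
    (forall t k, K ord0 t -> cell l' k t -> gam' t = `|k|%N%:R) ->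
    is_sargmax K psi' x -> is_largmax K psi' y -> `|x| < r -> `|y| < r ->
    (skorohod_dist B psi psi' < del%:E)%E ->
    (skorohod_dist1 (B ord0) gam gam' < del%:E)%E ->
    `|x - x0| <= e /\ `|y - y0| <= e.
Proof.
move=> BE [clB cB] sx0 ly0 x0r y0r e0.
have BK k t : B k t -> K k t by rewrite BE => -[].
have BrK z : rect B z -> rect K z by move=> Bz k; exact/BK/Bz.
have r0 : 0 < r by exact: le_lt_trans x0r.
have [k [s [ssup Vs wmax kuniq kgap]]] := unique_winner clK rep V_max V_distinct sx0.1.
have [cl cV psiV] := rep.
have [l_mono l_ex /andP[l0 l1]] := cl.
have [u [v [uv B0E]]] := compact_intervalE (clB ord0) (cB ord0).
have e20 : 0 < e / 2 by rewrite divr_gt0.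
have [eta eta0 heta] := winner_gap rep (BK : subrectangle B K) cB
  (fun t => (B0E t).1) kuniq kgap e20.
have [j1 [j2 jr]] := cells_range u v cl.
have [mu mu0 hmu] := uniform_range j1 j2
  (Q := fun j eta => (exists t, u <= t <= v /\ cell l j t) ->
    exists t, [/\ u <= t <= v, cell l j t & forall t', u <= t' <= v ->
      `|t' - t| <= eta -> (t = v -> t' = v) -> cell l j t'])
  (fun i e1 e2 _ e21 h act =>
     let: ex_intro t (And3 a b c) := h act in
     ex_intro _ t (And3 a b (fun t' ut' d tv => c t' ut' (le_trans d e21) tv)))
  (fun i => cell_margin l i uv).
(* [e / 2] complements the bound of [heta], [mu / 2] allows for two successive displacements, and
   the last two meet the sign condition of [cells_match]. *)
pose kap := Num.min (Num.min (e / 2) (mu / 2)) (Num.min (l 1 / 2) (- l 0 / 2)).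
have kap0 : 0 < kap by rewrite !lt_min e20 !divr_gt0// oppr_gt0.
have [kape kapmu kapl1 kapl0] :
    [/\ kap <= e / 2, kap <= mu / 2, kap <= l 1 / 2 & kap <= - l 0 / 2].
  by rewrite /kap !ge_min !lexx !orbT.
(* [2 * r] bounds the length of every side of [B]. *)
have [|del1 del10 hdel1] := @small_dist R (2 * r) kap _ kap0.
  by rewrite mulr_ge0// ltW.
(* [1] keeps the counts less than 1 apart; [eta / 4] keeps two errors [b] in the values below
   [eta]. *)
pose del := Num.min del1 (Num.min 1 (eta / 4)).
have del0 : 0 < del by rewrite !lt_min del10 ltr01 divr_gt0.
have [deld1 del1' deleta] : [/\ del <= del1, del <= 1 & del <= eta / 4].
  by rewrite /del !ge_min !lexx !orbT.
exists del => // psi' gam' l' V' x y rep' gamE' sx ly xr yr Dpsi Dgam.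
have [cl' cV' psiV'] := rep'.
have [l'_mono l'_ex _] := cl'.
have x0K : rect K x0 by case: sx0 => -[].
have Bx z : rect K z -> `|z| < r -> rect B z.
  move=> Kz /ltW/(rV_norm_leP _ (ltW r0)) zr j; rewrite BE; split; first exact: Kz.
  exact: zr.
have B0 : rect B !=set0 by exists x0; exact: Bx.
have B00 : B ord0 !=set0 by exists (x0 0 ord0); exact: Bx.
have [a [b [la [a0 b0 ab [tla la_a psi_b]]]]] := skorohod_dist_lt B0 Dpsi.
have [a' [b' [nu' [a'0 b'0 ab' [tnu nu_a gam_b]]]]] :=
  skorohod_dist_lt (rect1_nonempty B00) Dgam.
pose nu := nu' ord0.
have dev j f c t : time_change (B j) f -> 0 <= c -> c < del ->
    (log_slope (B j) f <= c%:E)%E -> B j t -> `|f t - t| <= kap.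
  move=> tf c0 cd fc Bt.
  have [p [q [pq BjE]]] := compact_intervalE (clB j) (cB j).
  have Bp : B j p by apply/BjE; rewrite lexx ltW.
  have Bq : B j q by apply/BjE; rewrite lexx ltW.
  have := Bp; rewrite {1}BE => -[_ /=]; rewrite ler_norml => /andP[rp _].
  have := Bq; rewrite {1}BE => -[_ /=]; rewrite ler_norml => /andP[_ qr].
  apply: le_trans (hdel1 c _); last by rewrite (le_trans (ltW cd)).
  apply: (time_change_dist tf Bp) => // t' /BjE /andP[pt tq].
  by rewrite pt/=; lra.
have la_dev z j : rect B z -> `|act la z 0 j - z 0 j| <= kap.
  move=> Bz; rewrite mxE; apply: (dev j _ a) => //; lra.
have nu_dev t : B ord0 t -> `|nu t - t| <= kap.
  move=> Bt; apply: (dev ord0 _ a') => //; [exact: tnu|lra|exact: nu_a].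
have tn : time_change (B ord0) nu by exact: tnu.
have nu_gam t : B ord0 t -> `|gam t - gam' (nu t)| < 1.
  move=> Bt; have := gam_b (const_mx t); rewrite !mxE => h.
  apply: le_lt_trans (h _) _; last by lra.
  by move=> j; rewrite mxE.
have match_k t j : B ord0 t -> cell l j t -> cell l' j (nu t).
  move=> Bt; have Bnu := time_change_in tn Bt.
  apply: (cells_match (I := K ord0) (f := gam) (f' := gam') (t := t) (kap := kap)) => //.
  - exact: BK Bt.
  - exact: BK Bnu.
  - exact: nu_gam.
  - exact: nu_dev.
  - lra.
  - lra.
(* [nu] is onto and the pieces of [l] cover the line, so every point of a piece of [l'] comes from
   the piece of [l] with the same index. *)
have match_inv t' j : B ord0 t' -> cell l' j t' ->
    exists t, [/\ B ord0 t, cell l j t & nu t = t'].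
  move=> Bt' jt'; have [t Bt nut] := time_change_surj tn Bt'.
  exists t; split => //; have [i it] := l_ex t.
  have := match_k _ _ Bt it; rewrite nut => /(cells_inj cl' jt') -> //.
have cB0 (z : 'rV[R]_m.+1) (C : set R) : `|z| < r ->
    closure (K ord0 `&` C) (z 0 ord0) -> closure (B ord0 `&` C) (z 0 ord0).
  move=> zr; have /(closure_truncate (A := K ord0 `&` C)) : `|z 0 ord0| < r.
    by apply: le_lt_trans zr; have /(rV_norm_leP _ (normr_ge0 _)) := lexx `|z|; exact.
  by rewrite BE setIAC; exact.
have [cx0 tx0] := wmax _ sx0.1; have [cy0 ty0] := wmax _ ly0.1.
have [t0 [Bt0 kt0]] := closure_nonempty (cB0 _ _ x0r cx0).
have xiB : rect (tail_sides B) (tail_coords x0) by apply: tail_rect; exact: Bx.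
(* A maximizer [z] of [psi'] lies over some piece [k']. A nearly maximal point [z'] of [psi] is
   built over piece [k'] of [l]; by [heta] that piece is the winning one. *)
have core z : is_maximizer K psi' z -> `|z| < r ->
  [/\ closure (B ord0 `&` cell l' k) (z 0 ord0),
     `|tail_coords z - tail_coords x0| <= e &
     (V' k (tail_coords z))%:E = sup_on (rect K) psi'].
  move=> /(maximizer_cellP _ clK rep')[Kz [k' [cz Vz]]] zr.
  have Bz := Bx _ Kz zr.
  have [t' [Bt' kt']] := closure_nonempty (cB0 _ _ zr cz).
  have [t [Bt kt _]] := match_inv _ _ Bt' kt'.
  have k'act : exists t, u <= t <= v /\ cell l k' t.
    by exists t; split => //; exact/B0E.
  have [tk [uvtk ktk tk_stable]] := hmu k' (jr _ _ ((B0E t).1 Bt) kt) k'act.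
  have Btk : B ord0 tk by exact/B0E.
  (* [w] has the last coordinates of [z] and lies over piece [k'] of [l'], so [psi' w] is the
     supremum of [psi']; its first coordinate comes from a stable test point. *)
  pose w := cons_coord (nu tk) (tail_coords z).
  have Bnutk := time_change_in tn Btk.
  have Bw : rect B w by apply: rect_cons_coord => //; exact: tail_rect.
  have psiw : psi' w = V' k' (tail_coords z).
    rewrite (psiV' _ k') ?tail_cons_coord//; first exact: BrK.
    by rewrite cons_coord0; exact: match_k.
  have Bp : rect B (cons_coord t0 (tail_coords x0)) by exact: rect_cons_coord.
  have psip : psi (cons_coord t0 (tail_coords x0)) = s.
    rewrite (psiV _ k) ?tail_cons_coord//; first exact: BrK.
    by rewrite cons_coord0.
  (* At the image under [la] of a maximum point of [psi], [psi'] is at least [s - b]. *)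
  have psiw_ge : s - b <= psi' w.
    have h1 := psi_b _ Bp; rewrite psip in h1.
    have h2 : psi' (act la (cons_coord t0 (tail_coords x0))) <= psi' w.
      rewrite -lee_fin psiw Vz; apply: ereal_sup_ubound.
      by eexists; last reflexivity; apply: BrK; exact: act_rect.
    by move: h1; rewrite ler_norml => /andP[? ?]; lra.
  have /choice[w' w'P] : forall j, exists p, B j p /\ la j p = w 0 j.
    move=> j; have [p Bp' lap] := time_change_surj (tla j) (Bw j).
    by exists p.
  pose z' : 'rV[R]_m.+1 := \row_j w' j.
  have Bz' : rect B z' by move=> j; rewrite mxE; case: (w'P j).
  have lz' : act la z' = w by apply/rowP => j; rewrite !mxE; case: (w'P j) => _ ->; rewrite !mxE.
  have psiz' : s - eta < psi z'.
    have := psi_b _ Bz'; rewrite lz' ler_norml => /andP[? ?]; lra.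
  have [kz' tz'] := heta _ Bz' psiz'.
  have wz' j : `|w 0 j - z' 0 j| <= kap by rewrite -{1}lz'; exact: la_dev.
  (* The first coordinate of [z'] is within [2 * kap <= mu] of [tk]: one [kap] for [nu], one for
     [la]. *)
  have k'z' : cell l k' (z' 0 ord0).
    apply: tk_stable; first by apply/B0E; exact: Bz'.
      have := wz' ord0; rewrite cons_coord0 !ler_norml => /andP[? ?].
      by have := nu_dev _ Btk; rewrite ler_norml => /andP[? ?]; apply/andP; split; lra.
    (* At the right end [v] no margin is available, but both time changes fix it. *)
    move=> tkv.
    have Bv : B ord0 v by apply/B0E; rewrite lexx ltW.
    have vmax t1 : B ord0 t1 -> t1 <= v by move=> /B0E /andP[].
    have nuv : nu v = v by exact: (time_change_right tn Bv vmax).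
    have lav : la ord0 v = v by exact: (time_change_right (tla ord0) Bv vmax).
    apply: (time_change_inj (tla ord0)) => //.
    have := congr1 (fun q : 'rV[R]_m.+1 => q 0 ord0) lz'.
    by rewrite cons_coord0 mxE tkv nuv lav.
  have k'k : k' = k by exact: (cells_inj cl k'z' kz').
  subst k'; split => //; first exact: cB0.
  apply/(rV_norm_leP _ (ltW e0)) => j.
  have /(rV_norm_leP _ (ltW e20)) /(_ j) := tz'.
  have := wz' (lift ord0 j); rewrite !mxE liftK !mxE.
  rewrite !ler_norml => /andP[? ?] /andP[? ?]; apply/andP; split; lra.
have [cx tx Vx] := core _ sx.1 xr; have [cy ty Vy] := core _ ly.1 yr.
have SS' t : (B ord0 `&` cell l k) t ->
    exists2 t', (B ord0 `&` cell l' k) t' & `|t' - t| <= kap.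
  move=> [Bt kt]; exists (nu t); last exact: nu_dev.
  by split; [exact: (time_change_in tn)|exact: match_k].
have S'S t' : (B ord0 `&` cell l' k) t' ->
    exists2 t, (B ord0 `&` cell l k) t & `|t' - t| <= kap.
  move=> [Bt' kt']; have [t [Bt kt <-]] := match_inv _ _ Bt' kt'.
  by exists t => //; exact: nu_dev.
(* All points over the winning piece with these last coordinates are maximizers, so the first
   coordinates of the sargmaxes are the lower ends of the matched pieces within [B], and those of
   the largmaxes the upper ends. *)
have max0 t : (B ord0 `&` cell l k) t -> is_maximizer K psi (cons_coord t (tail_coords x0)).
  move=> [Bt kt]; apply/(maximizer_cellP _ clK rep); split.
    by apply: rect_cons_coord; [exact: BK|exact: tail_rect].
  exists k; rewrite cons_coord0 tail_cons_coord Vs; split => //.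
  by apply: subset_closure; split => //; exact: BK.
have max' z t : rect K z -> (V' k (tail_coords z))%:E = sup_on (rect K) psi' ->
    (B ord0 `&` cell l' k) t -> is_maximizer K psi' (cons_coord t (tail_coords z)).
  move=> Kz Vz [Bt kt]; apply/(maximizer_cellP _ clK rep'); split.
    by apply: rect_cons_coord; [exact: BK|exact: tail_rect].
  exists k; rewrite cons_coord0 tail_cons_coord Vz; split => //.
  by apply: subset_closure; split => //; exact: BK.
have kape' : kap <= e by lra.
have first_x : `|x 0 ord0 - x0 0 ord0| <= kap.
  apply: (lower_ends_close (cB0 _ _ x0r cx0) cx _ _ SS' S'S) => t.
    by move=> /max0 /(sx0.2 ord0); rewrite cons_coord0; exact.
  by move=> /(max' _ _ sx.1.1 Vx) /(sx.2 ord0); rewrite cons_coord0; exact.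
have first_y : `|y 0 ord0 - y0 0 ord0| <= kap.
  apply: (upper_ends_close (cB0 _ _ y0r cy0) cy _ _ SS' S'S) => t.
    by move=> /max0 /(ly0.2 ord0); rewrite cons_coord0; exact.
  by move=> /(max' _ _ ly.1.1 Vy) /(ly.2 ord0); rewrite cons_coord0; exact.
split; apply: norm_head_tail; rewrite ?ty0 ?(le_trans first_x) ?(le_trans first_y)//; exact: ltW.
Qed.
End argmax_continuity.

(** * Weak convergence *)

Section assembly.
Context {R : realType} {m : nat}.

(** [N0] is large enough for every truncated side to contain two chosen distinct points of the
    original side, hence to be nondegenerate. *)
Lemma truncated_rectangle (K : 'I_m.+1 -> set R) : closed_rectangle K ->
  exists N0 : nat, forall N, (N0 <= N)%N ->
    compact_rectangle (fun k => K k `&` [set t | `|t| <= N%:R]).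
Proof.
move=> clK.
have /choice[pq pqP] : forall k, exists p : R * R, [/\ K k p.1, K k p.2 & p.1 < p.2].
  by move=> k; have [_ _ [x [y [? ? ?]]]] := clK k; exists (x, y).
have /choice[b bP] : forall k, exists b : nat, `|(pq k).1| <= b%:R /\ `|(pq k).2| <= b%:R.
  move=> k; exists (Num.truncn (Num.max `|(pq k).1| `|(pq k).2|)).+1.
  have := truncnS_gt (Num.max `|(pq k).1| `|(pq k).2|).
  by rewrite gt_max => /andP[/ltW ? /ltW ?].
exists (\max_k b k)%N => N N0.
have bN k : (b k)%:R <= N%:R :> R.
  by rewrite ler_nat (leq_trans _ N0)// (leq_bigmax k).
have segE : [set t : R | `|t| <= N%:R] = `[- N%:R, N%:R]%classic.
  by apply/seteqP; split => t /=; rewrite in_itv/= ler_norml.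
split=> k; last first.
  rewrite segE setIC; apply: compact_closedI; first exact: segment_compact.
  by have [_] := clK k.
have [itvK cK _] := clK k; split.
- move=> x y [Kx xN] [Ky yN] z xzy; split; first exact: (itvK _ _ Kx Ky).
  move: xN yN xzy; rewrite /= !ler_norml => /andP[? ?] /andP[? ?] /andP[? ?].
  by apply/andP; split; lra.
- by rewrite segE; apply: closedI => //; exact: itv_closed.
- have [K1 K2 lt12] := pqP k; have [b1 b2] := bP k.
  by exists (pq k).1, (pq k).2; split => //; split => //=; exact: le_trans (bN k).
Qed.

Context {dO : measure_display} {Omega : measurableType dO}.

Lemma borel_measurable_comp (T : topologicalType) (X : Omega -> T) (f : T -> R) :
  borel_measurable X -> continuous f -> measurable_fun setT (f \o X).
Proof.
move=> mX cf mD; apply: (measurability _ (RGenOInfty.measurableE R)) => //.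
move=> _ [_ [x ->] <-]; rewrite setTI.
rewrite comp_preimage; apply: mX; apply: sub_sigma_algebra.
by move/continuousP : cf; apply; exact: rray_open.
Qed.
End assembly.

(** * Weak convergence of the argmaxes *)

Section weak_convergence.
Context {R : realType} {m : nat} (K : 'I_m.+1 -> set R).
Context {dO : measure_display} {Omega : measurableType dO} (P : probability Omega R).
Variables (Psi : nat -> Omega -> D0_space K) (Gamma : nat -> Omega -> S_space (K ord0)).
Let K2 := rect (tail_sides K).
Let argmaxes n w := (sargmax K (Psi n w), largmax K (Psi n w)).
Hypothesis clK : closed_rectangle K.
Hypothesis mX : forall n (B : 'I_m.+1 -> set R) (BK : subrectangle B K),
  compact_rectangle B ->
  borel_measurable (fun w =>
    (D0_restrict BK (Psi n w), S_restrict (BK ord0) (Gamma n w))).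
Hypothesis formX : forall n, {ae P, forall w, form_J_for K (Psi n w) (Gamma n w)}.
Hypothesis form0 : {ae P, forall w, exists a V,
  [/\ form_J K (Psi 0%N w) a V,
      counts_jumps (K ord0) (Gamma 0%N w) a,
      forall j, exists! xi, K2 xi /\ forall eta, K2 eta -> V j eta <= V j xi &
      forall A : set int, finite_set A -> A !=set0 ->
        exists! j, A j /\
          ereal_sup [set sup_on K2 (V i) | i in A] = sup_on K2 (V j)]}.
Hypothesis defX : forall n, {ae P, forall w, argmaxes_defined K (Psi n w)}.
Hypothesis cvgX : forall (B : 'I_m.+1 -> set R) (BK : subrectangle B K),
  compact_rectangle B ->
  let X n w := (D0_restrict BK (Psi n w), S_restrict (BK ord0) (Gamma n w)) in
  cvg_in_distribution P X (X 0%N).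
Hypothesis tight : bounded_in_probability P argmaxes.

Let T := ('rV[R]_m.+1 * 'rV[R]_m.+1)%type.

(** Absorbs the null set of [Q] into the exceptional set at no cost in measure. *)
Lemma ae_setC (A : set Omega) (Q : Omega -> Prop) (e : R) : measurable A ->
  (P A <= e%:E)%E -> {ae P, forall w, Q w} ->
  exists A', [/\ measurable A', (P A' <= e%:E)%E, A `<=` A' & forall w, ~ A' w -> Q w].
Proof.
move=> mA PA [N [mN PN NQ]]; exists (A `|` N); split.
- exact: measurableU.
- apply: le_trans (measureU2 _ mA mN) _.
  have PN0 : (P N <= 0)%E by rewrite PN.
  by rewrite -[leRHS]adde0; exact: leeD PA PN0.
- by move=> w; left.
- by move=> w nAN; apply: contrapT => /NQ Nw; apply: nAN; right.
Qed.

Lemma argmaxes_lower_approximable (C : R) (phi : T -> R) :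
  continuous phi -> (forall z, 0 <= phi z <= C) ->
  lower_approximable P C (fun n w => phi (argmaxes n w)).
Proof.
move=> cphi phiC.
have C0 : 0 <= C by have /andP[/le_trans h /h] := phiC (0, 0).
have phi0 z : 0 <= phi z by case/andP: (phiC z).
have [N0 cN0] := truncated_rectangle clK.
(* The shift by [N0] makes [B N] a compact nondegenerate rectangle for every [N]. *)
pose r (N : nat) : R := (N + N0)%:R.
pose B N k := K k `&` [set t | `|t| <= r N].
have cB N : compact_rectangle (B N) by apply: cN0; rewrite leq_addl.
have BK N : subrectangle (B N) K by move=> k t [].
have B0 N : rect (B N) !=set0.
  have [clB _] := cB N.
  have /choice[b bP] k : exists b, B N k b.
    by have [_ _ [b [_ [? _ _]]]] := clB k; exists b.
  by exists (\row_k b k) => k; rewrite mxE.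
have B00 N : B N ord0 !=set0.
  by have [clB _] := cB N; have [_ _ [b [_ [? _ _]]]] := clB ord0; exists b.
pose I := (D0_space K * S_space (K ord0))%type.
pose am (i : I) : T := (sargmax K i.1, largmax K i.1).
(* The strict norm bound places the argmaxes over [K] inside [B N], where [d N] compares the
   functions. *)
pose S N : set I := [set i : I | [/\ form_J_for K i.1 i.2, argmaxes_defined K i.1 &
                                 `|am i| < r N]].
pose rest N (i : I) : D0_space (B N) * S_space (B N ord0) :=
  (D0_restrict (BK N) i.1, S_restrict (BK N ord0) i.2).
pose X N n w := rest N (Psi n w, Gamma n w).
pose d N (x : D0_space (B N) * S_space (B N ord0)) i := pair_dist x (rest N i).
have d0 N x i : 0 <= d N x i by exact: pair_dist_ge0.
have dX N n w : d N (X N n w) (Psi n w, Gamma n w) = 0.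
  exact: pair_dist_refl.
pose env N (c : nat) := lower_envelope C (S N) (phi \o am) (d N) c%:R.
have h0 (i : I) : 0 <= (phi \o am) i by exact: phi0.
have n0 (c : nat) : (0 : R) <= c%:R by [].
have cenv N c : continuous (env N c).
  apply: lower_envelope_continuous => // x e e0.
  near=> x'; move=> i; rewrite /d.
  have : forall y, `|pair_dist x y - pair_dist x' y| <= e.
    by near: x'; exact: pair_dist_near.
  exact.
have envC N c x : 0 <= env N c x <= C by exact: lower_envelope_bounds.
apply: (envelopes_lower_approximable (g := fun N c n w => env N c (X N n w))).
- by move=> N c n; apply: (borel_measurable_comp (X := X N n)) => //; exact: mX.
- by move=> N c n w.
- by move=> N n w c c' cc'; apply: lower_envelope_nondecreasing => //; rewrite ler_nat.
- move=> N c.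
  have := @cvgX _ (BK N) (cB N) (env N c) (@cenv N c).
  rewrite unlock; apply.
  by exists C => x; have /andP[? ?] := envC N c x; rewrite ger0_norm.
(* Off the exceptional set the pair of index [n] belongs to [S N] and is at distance 0 from its own
   restriction, so the envelope is at most [phi] of its argmaxes. *)
- move=> e e0; have [M HM] := tight e0.
  near=> N => n npos.
  have MN : M < r N.
    rewrite /r natrD ltr_wpDr//.
    near: N; exact: nbhs_infty_gtr.
  have [A0 [mA0 PA0 A0M]] := HM _ npos.
  have [A1 [mA1 PA1 A01 A1f]] := ae_setC mA0 PA0 (formX n).
  have [A2 [mA2 PA2 A12 A2d]] := ae_setC mA1 PA1 (defX n).
  exists A2; split => // c w nA2.
  have Si : S N (Psi n w, Gamma n w).
    split => /=; [by apply: A1f => /A12|exact: A2d|].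
    apply: le_lt_trans MN; rewrite leNgt; apply/negP => lM.
    by apply: nA2; apply/A12/A01/A0M.
  apply: le_trans (lower_envelope_le _ h0 (@d0 N) _ (n0 c) Si) _.
    exact: C0.
  by rewrite dX mulr0 addr0.
(* Once [r N] exceeds the norm of the argmaxes of [Psi 0 w], this pair is itself in [S N]; the lower
   semicontinuity along [S N] is [argmaxes_continuous]. *)
- apply: filterS2 form0 (filterI (formX 0%N) (defX 0%N)).
  move=> w [a [V [J cJ V_max V_distinct]]] [formw defw].
  have [x0 y0] := defw.
  have sx0 : is_sargmax K (Psi 0%N w) (sargmax K (Psi 0%N w)) by exact: (xgetPex 0).
  have ly0 : is_largmax K (Psi 0%N w) (largmax K (Psi 0%N w)) by exact: (xgetPex 0).
  near=> N.
  have aN : `|argmaxes 0%N w| < r N.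
    rewrite /r natrD ltr_wpDr//.
    near: N; exact: nbhs_infty_gtr.
  apply: lower_envelope_cvg => //.
    exists (Psi 0%N w, Gamma 0%N w); first by split.
    by rewrite dX.
  move=> e e0.
  have [e' e'0 he'] : exists2 e' : R, 0 < e' & forall z : T,
      `|z - argmaxes 0%N w| <= e' -> phi (argmaxes 0%N w) - e <= phi z.
    have /cvgrPdist_le/(_ _ e0) := cphi (argmaxes 0%N w).
    rewrite -nbhs_ballE => -[e' /= e'0 he'].
    exists (e' / 2); first by rewrite divr_gt0.
    move=> z ze'; have := he' z; rewrite -ball_normE /= distrC => h.
    have := h _; rewrite ler_norml => h1.
    have /h1 /andP[_] : `|z - argmaxes 0%N w| < e'.
      by apply: le_lt_trans ze' _; rewrite ltr_pdivrMr// ltr_pMr// ltr1n.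
    by rewrite lerBlDr lerBlDl addrC.
  have rep := form_J_cell_rep J.
  have ja : jump_sequence a by case: J.
  have gamE t k : K ord0 t -> cell (cell_start a) k t -> Gamma 0%N w t = `|k|%N%:R.
    by move=> Kt kt; exact: (cells_counts ja cJ Kt kt).
  have [x0r y0r] : `|sargmax K (Psi 0%N w)| < r N /\ `|largmax K (Psi 0%N w)| < r N.
    by move: aN; rewrite prod_normE/= gt_max => /andP[].
  have [del del0 hdel] := argmaxes_continuous clK rep gamE V_max V_distinct
    (fun k => erefl) (cB N) sx0 ly0 x0r y0r e'0.
  (* Below 1 the truncated distances agree with the Skorohod distances. *)
  exists (Num.min del 1); first by rewrite lt_min del0/=.
  move=> [psi' gam'] [/= [a' [V' [J' cJ']]] [ex' ey']] /=.
  rewrite prod_normE/= gt_max => /andP[xr' yr'].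
  move=> dlt.
  have m1 : Num.min del 1 <= 1 by rewrite ge_min lexx orbT.
  have md : ((Num.min del 1)%:E <= del%:E)%E by rewrite lee_fin ge_min lexx.
  have [D1 D2] := pair_dist_lt (B0 N) (B00 N) m1 dlt.
  have ja' : jump_sequence a' by case: J'.
  have gamE' t k : K ord0 t -> cell (cell_start a') k t -> gam' t = `|k|%N%:R.
    by move=> Kt kt; exact: (cells_counts ja' cJ' Kt kt).
  have sx' : is_sargmax K psi' (sargmax K psi') by exact: (xgetPex 0).
  have ly' : is_largmax K psi' (largmax K psi') by exact: (xgetPex 0).
  have [hx hy] := hdel _ _ _ _ _ _ (form_J_cell_rep J') gamE' sx' ly' xr' yr'
    (lt_le_trans D1 md) (lt_le_trans D2 md).
  by apply: he'; rewrite prod_normE/= ge_max hx hy.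
Unshelve. all: by end_near. Qed.

(** [h] is split into its positive and negative parts, with values in [[0, M]]; for such a [phi],
    approximability of both [phi] and [M - phi] gives convergence. *)
Lemma cvg_argmaxes : cvg_in_distribution P argmaxes (argmaxes 0%N).
Proof.
move=> h ch [M hM]; rewrite unlock.
have M0 : 0 <= M by apply: le_trans (hM (0, 0)).
have key (phi : T -> R) : continuous phi -> (forall z, 0 <= phi z <= M) ->
    (\int[P]_w (phi (argmaxes n w))%:E @[n --> \oo] -->
     \int[P]_w (phi (argmaxes 0%N w))%:E)%E.
  move=> cphi phiM.
  apply: (lower_approximable_cvg (C := M)) => //.
    exact: argmaxes_lower_approximable.
  apply: (argmaxes_lower_approximable (phi := fun z => M - phi z)).
    by move=> z; apply: cvgB; [exact: cvg_cst|exact: cphi].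
  by move=> z; have /andP[? ?] := phiM z; apply/andP; split; lra.
have cp : continuous (fun z => Num.max (h z) 0).
  move=> z; apply: (@continuous_max R _ h (cst 0)); first exact: ch.
  exact: cvg_cst.
have cn : continuous (fun z => Num.max (- h z) 0).
  move=> z; apply: (@continuous_max R _ (fun z => - h z) (cst 0)).
    by apply: cvgN; exact: ch.
  exact: cvg_cst.
have hp z : 0 <= Num.max (h z) 0 <= M.
  by have := hM z; rewrite ler_norml le_max lexx orbT ge_max M0 andbT => /andP[].
have hn z : 0 <= Num.max (- h z) 0 <= M.
  by have := hM z; rewrite ler_norml le_max lexx orbT ge_max M0 andbT lerNl => /andP[].
(* The integral is by definition the difference of the integrals of the two parts, so the splitting
   requires no additivity. *)
have intE n : (\int[P]_w (h (argmaxes n w))%:E =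
    \int[P]_w (Num.max (h (argmaxes n w)) 0)%:E -
    \int[P]_w (Num.max (- h (argmaxes n w)) 0)%:E)%E.
  rewrite integralE; congr (_ - _)%E; apply: eq_integral => w _.
    by rewrite funeposE -EFin_max.
  by rewrite funenegE -EFin_max.
rewrite (_ : (fun n => _) = (fun n =>
    \int[P]_w (Num.max (h (argmaxes n w)) 0)%:E -
    \int[P]_w (Num.max (- h (argmaxes n w)) 0)%:E)%E); last first.
  by apply/funext => n; exact: intE.
have -> : (\int[P]_w ((h \o argmaxes 0%N) w)%:E =
    \int[P]_w (Num.max (h (argmaxes 0%N w)) 0)%:E -
    \int[P]_w (Num.max (- h (argmaxes 0%N w)) 0)%:E)%E by exact: intE.
apply: cvgeB; [|exact: (key _ cp hp)|exact: (key _ cn hn)].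
apply: fin_num_adde_defr.
by apply: (@integral_bounded_fin_num _ _ _ _ _ M) => w; exact: hp.
Qed.
End weak_convergence.

Theorem theorem3p2 (R : realType) (m : nat) (K : 'I_m.+1 -> set R)
    (dO : measure_display) (Omega : measurableType dO)
    (P : probability Omega R)
    (Psi : nat -> Omega -> D0_space K)
    (Gamma : nat -> Omega -> S_space (K ord0)) :
  let K2 := rect (tail_sides K) in
  let argmaxes n w := (sargmax K (Psi n w), largmax K (Psi n w)) in
  closed_rectangle K ->
  (K ord0)^° 0 ->
  (forall n (B : 'I_m.+1 -> set R) (BK : subrectangle B K),
     compact_rectangle B ->
     borel_measurable (fun w =>
       (D0_restrict BK (Psi n w), S_restrict (BK ord0) (Gamma n w)))) ->
  (forall n, {ae P, forall w, form_J_for K (Psi n w) (Gamma n w)}) ->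
  {ae P, forall w, exists a V,
     [/\ form_J K (Psi 0%N w) a V,
         counts_jumps (K ord0) (Gamma 0%N w) a,
         forall j, exists! xi, K2 xi /\ forall eta, K2 eta -> V j eta <= V j xi &
         forall A : set int, finite_set A -> A !=set0 ->
           exists! j, A j /\
             ereal_sup [set sup_on K2 (V i) | i in A] = sup_on K2 (V j)]} ->
  {ae P, forall w, argmaxes_defined K (Psi 0%N w)} ->
  (forall t, K ord0 t ->
     P.-negligible [set w | jumps_at (K ord0) (Gamma 0%N w) t]) ->
  (forall (B : 'I_m.+1 -> set R) (BK : subrectangle B K),
     compact_rectangle B ->
     let X n w := (D0_restrict BK (Psi n w), S_restrict (BK ord0) (Gamma n w)) in
     cvg_in_distribution P X (X 0%N)) ->
  (forall n, (0 < n)%N -> {ae P, forall w, argmaxes_defined K (Psi n w)}) ->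
  bounded_in_probability P argmaxes ->
  cvg_in_distribution P argmaxes (argmaxes 0%N).
Proof.
move=> K2 argmaxes clK _ mX formX form0 def0 _ cvgX defX tight.
apply: (cvg_argmaxes clK mX formX form0 _ cvgX tight); case=> [|n]; first exact: def0.
exact: defX.
Qed.
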